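(* If $\beta,\gamma\in B_3$ satisfy $V_{\widehat\beta}=V_{\widehat\gamma}$, then $P_{\widehat\beta}=P_{\widehat\gamma}$.
   Context: $B_3$ is the braid group on three strands; $\widehat\beta$ is the oriented link obtained by the standard closure of $\beta$. The Homflypt polynomial $P_L(v,z)$ of an oriented link $L$ is determined by $P=1$ on the unknot and $P_{D_+}=vz\,P_{D_0}+v^2P_{D_-}$ for diagrams differing at one crossing (positive, smoothed, negative). The Jones polynomial is $V_L(t)=P_L(t,\,t^{1/2}-t^{-1/2})$. *)

(* Defs.v *)
From HB Require Import structures.
From Stdlib Require Import Relations.
From mathcomp Require Import all_boot all_algebra finmap boolp monalg.

Set Implicit Arguments.
Unset Strict Implicit.
Unset Printing Implicit Defensive.

Import GRing.Theory.

(* Oriented link diagrams in Morse position, read from bottom to top.  A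
   horizontal line in general position meets the diagram in a sequence of
   strands, recorded by their orientations ([true] is upwards).  An event
   [(i, e)] places the elementary piece [e] with exactly [i] strands to its
   left:
   - [Cup o] creates two adjacent strands, the left one oriented by [o];
   - [Cap] joins two adjacent strands;
   - [Cross b] crosses two adjacent strands; the strand going from bottom left
     to top right is the overstrand iff [b]. *)
Inductive piece := Cup of bool | Cap | Cross of bool.

Definition event := (nat * piece)%type.

Definition piece_code (e : piece) : option (bool * bool) :=
  match e with
  | Cup o => Some (true, o)
  | Cross b => Some (false, b)
  | Cap => None
  end.

Definition piece_decode (c : option (bool * bool)) : piece :=
  match c with
  | Some (true, o) => Cup o
  | Some (false, b) => Cross b
  | None => Cap
  end.

Lemma piece_codeK : cancel piece_code piece_decode.
Proof. by case. Qed.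

HB.instance Definition _ := Countable.copy piece (can_type piece_codeK).

Definition strands_in (e : piece) : nat := if e is Cup _ then 0 else 2.
Definition strands_out (e : piece) : nat := if e is Cap then 0 else 2.

Definition step (w : seq bool) (x : event) : option (seq bool) :=
  let: (i, e) := x in
  match e, drop i w with
  | Cup o, w' =>
      if i <= size w then Some (take i w ++ o :: ~~ o :: w') else None
  | Cap, o1 :: o2 :: w' =>
      if o1 != o2 then Some (take i w ++ w') else None
  | Cross _, o1 :: o2 :: w' => Some (take i w ++ o2 :: o1 :: w')
  | _, _ => None
  end.

Fixpoint run (w : seq bool) (s : seq event) : option (seq bool) :=
  if s is x :: s' then obind (run^~ s') (step w x) else Some w.

Record link_diagram := LinkDiagram {
  events :> seq event;
  eventsP : run [::] events == Some [::]
}.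

HB.instance Definition _ := [isSub for events].
HB.instance Definition _ := [Choice of link_diagram by <:].

(* Plane isotopies ([Far], [ZigzagL], [ZigzagR], [SlideCup], [SlideCap]) and
   Reidemeister moves for diagrams in Morse position (Freyd-Yetter, Turaev,
   Kauffman).  Orientations are propagated by [run], so that the moves are
   those of unoriented diagrams; the remaining orientations and crossing types
   of the first and third Reidemeister moves follow from the ones below. *)
Inductive local_move : seq event -> seq event -> Prop :=
| Far i k e f :
    local_move [:: (i, e); (i + strands_out e + k, f)]
               [:: (i + strands_in e + k, f); (i, e)]
| ZigzagL i o : local_move [:: (i, Cup o); (i.+1, Cap)] [::]
| ZigzagR i o : local_move [:: (i.+1, Cup o); (i, Cap)] [::]
| SlideCup i o b :
    local_move [:: (i.+1, Cup o); (i, Cross b)]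
               [:: (i, Cup o); (i.+1, Cross (~~ b))]
| SlideCap i b :
    local_move [:: (i, Cross b); (i.+1, Cap)]
               [:: (i.+1, Cross (~~ b)); (i, Cap)]
| R1Cup i o b :
    local_move [:: (i, Cup o); (i, Cross b)] [:: (i, Cup (~~ o))]
| R1Cap i b : local_move [:: (i, Cross b); (i, Cap)] [:: (i, Cap)]
| R2 i b : local_move [:: (i, Cross b); (i, Cross (~~ b))] [::]
| R3 i b :
    local_move [:: (i, Cross b); (i.+1, Cross b); (i, Cross b)]
               [:: (i.+1, Cross b); (i, Cross b); (i.+1, Cross b)].

Definition in_context (T : Type) (r : seq T -> seq T -> Prop) (s s' : seq T) :=
  exists u m m' v, [/\ r m m', s = u ++ m ++ v & s' = u ++ m' ++ v].

Definition diagram_move (D D' : link_diagram) : Prop :=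
  in_context local_move D D'.

Definition isotopic : link_diagram -> link_diagram -> Prop :=
  clos_refl_sym_trans _ diagram_move.

Section ClosEquiv.
Variables (T : choiceType) (r : T -> T -> Prop).

Definition closb : rel T := fun x y => `[< clos_refl_sym_trans _ r x y >].

Lemma closb_refl : reflexive closb.
Proof. by move=> x; apply/asboolP/rst_refl. Qed.

Lemma closb_sym : symmetric closb.
Proof. by move=> x y; apply/asboolP/asboolP; apply: rst_sym. Qed.

Lemma closb_trans : transitive closb.
Proof.
by move=> y x z /asboolP xy /asboolP yz; apply/asboolP; apply: rst_trans xy yz.
Qed.
End ClosEquiv.

Arguments closb_refl {T} r.
Arguments closb_sym {T} r.
Arguments closb_trans {T} r.

Definition isotopicb : rel link_diagram := closb diagram_move.

Canonical isotopicb_equiv :=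
  EquivRel isotopicb (closb_refl _) (closb_sym _) (closb_trans _).

Definition oriented_link := {eq_quot isotopicb}%qT.
HB.instance Definition _ := Choice.on oriented_link.
HB.instance Definition _ := EqQuotient.on oriented_link.

Definition link_of (D : link_diagram) : oriented_link :=
  (\pi_oriented_link D)%qT.

Lemma link_ofP (D D' : link_diagram) :
  link_of D = link_of D' <-> isotopic D D'.
Proof.
split; first by move/eqmodP/asboolP.
by move=> h; apply/eqmodP/asboolP.
Qed.

Definition unknot_diagram : link_diagram :=
  @LinkDiagram [:: (0, Cup true); (0, Cap)] isT.

(* Below, [o1] and [o2] are the orientations of the left and right strands just
   before the crossing.  Where they agree, the crossing is positive iff its
   overstrand goes from bottom left to top right; where they differ, it is
   positive iff its overstrand goes from bottom right to top left.  The smoothing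
   that respects the orientations consists of two vertical arcs in the first
   case, and of a cap followed by a cup in the second. *)
Definition positive_crossing (o1 o2 : bool) : piece := Cross (o1 == o2).
Definition negative_crossing (o1 o2 : bool) : piece := Cross (o1 != o2).
Definition smoothing (i : nat) (o1 o2 : bool) : seq event :=
  if o1 == o2 then [::] else [:: (i, Cap); (i, Cup o2)].

Definition skein_triple (Dp D0 Dm : link_diagram) : Prop :=
  exists (u v : seq event) (w1 w2 : seq bool) (o1 o2 : bool),
    let i := size w1 in
    [/\ run [::] u = Some (w1 ++ o1 :: o2 :: w2),
        events Dp = u ++ (i, positive_crossing o1 o2) :: v,
        events D0 = u ++ smoothing i o1 o2 ++ v &
        events Dm = u ++ (i, negative_crossing o1 o2) :: v].

(* The letter [(i, true)] stands for the Artin generator with index [i + 1],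
   [(i, false)] for its inverse. *)
Definition braid_word (n : nat) := seq ('I_n.-1 * bool).

Inductive braid_relation (n : nat) : braid_word n -> braid_word n -> Prop :=
| BraidCancel i b : braid_relation [:: (i, b); (i, ~~ b)] [::]
| BraidFar (i j : 'I_n.-1) : i.+1 < j ->
    braid_relation [:: (i, true); (j, true)] [:: (j, true); (i, true)]
| BraidArtin (i j : 'I_n.-1) : i.+1 = j ->
    braid_relation [:: (i, true); (j, true); (i, true)]
                   [:: (j, true); (i, true); (j, true)].

Definition braid_move (n : nat) : braid_word n -> braid_word n -> Prop :=
  in_context (@braid_relation n).

Definition braid_equivb (n : nat) : rel (braid_word n) := closb (@braid_move n).

Canonical braid_equivb_equiv (n : nat) :=
  EquivRel (@braid_equivb n) (closb_refl _) (closb_sym _) (closb_trans _).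

Definition braid (n : nat) := {eq_quot @braid_equivb n}%qT.
HB.instance Definition _ n := Choice.on (braid n).
HB.instance Definition _ n := EqQuotient.on (braid n).

Definition braid_of (n : nat) (w : braid_word n) : braid n :=
  (\pi_(braid n) w)%qT.

Section BraidGroup.
Variable n : nat.
Implicit Types (u v w : braid_word n) (x y z : braid n).

Lemma braid_ofP u v :
  braid_of u = braid_of v <-> clos_refl_sym_trans _ (@braid_move n) u v.
Proof.
split; first by move/eqmodP/asboolP.
by move=> h; apply/eqmodP/asboolP.
Qed.

Lemma braid_ofE x : exists w, x = braid_of w.
Proof. by exists (repr x); rewrite /braid_of reprK. Qed.

Lemma braid_move_cat a b u v :
  braid_move u v -> braid_move (a ++ u ++ b) (a ++ v ++ b).
Proof.
case=> c [m [m' [d [mm' -> ->]]]]; exists (a ++ c), m, m', (d ++ b).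
by rewrite !catA.
Qed.

Lemma braid_clos_cat a b u v : clos_refl_sym_trans _ (@braid_move n) u v ->
  clos_refl_sym_trans _ (@braid_move n) (a ++ u ++ b) (a ++ v ++ b).
Proof.
elim=> {u v} [u v uv|u|u v _|u v w _ + _].
- by apply/rst_step/braid_move_cat.
- exact: rst_refl.
- exact: rst_sym.
- exact: rst_trans.
Qed.

Lemma braid_of_cat u u' v v' : braid_of u = braid_of u' ->
  braid_of v = braid_of v' -> braid_of (u ++ v) = braid_of (u' ++ v').
Proof.
move=> /braid_ofP hu /braid_ofP hv; apply/braid_ofP.
apply: (rst_trans _ _ _ (u' ++ v)); first exact: (@braid_clos_cat [::] v).
by have:= @braid_clos_cat u' [::] _ _ hv; rewrite !cats0.
Qed.

Definition inverse_word w : braid_word n := rev [seq (a.1, ~~ a.2) | a <- w].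

Definition braid_one : braid n := braid_of [::].
Definition braid_mul x y : braid n := braid_of (repr x ++ repr y).
Definition braid_inv x : braid n := braid_of (inverse_word (repr x)).

Lemma braid_of_repr x : braid_of (repr x) = x.
Proof. by rewrite /braid_of reprK. Qed.

Lemma braid_mulE u v : braid_mul (braid_of u) (braid_of v) = braid_of (u ++ v).
Proof. by apply: braid_of_cat; rewrite braid_of_repr. Qed.

Lemma braid_cancel i b : braid_of [:: (i, b); (i, ~~ b)] = braid_one.
Proof.
apply/braid_ofP/rst_step.
by exists [::], [:: (i, b); (i, ~~ b)], [::], [::]; split; first constructor.
Qed.

Lemma braid_mulA : associative braid_mul.
Proof.
move=> x y z; have [u ->] := braid_ofE x; have [v ->] := braid_ofE y.
by have [w ->] := braid_ofE z; rewrite !braid_mulE catA.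
Qed.

Lemma braid_mul1 : left_id braid_one braid_mul.
Proof. by move=> x; have [u ->] := braid_ofE x; rewrite braid_mulE. Qed.

Lemma braid_1mul : right_id braid_one braid_mul.
Proof. by move=> x; have [u ->] := braid_ofE x; rewrite braid_mulE cats0. Qed.

Lemma inverse_wordK : involutive inverse_word.
Proof.
move=> w; rewrite /inverse_word map_rev revK -map_comp -[RHS]map_id.
by apply: eq_map => -[i b] /=; rewrite negbK.
Qed.

Lemma braid_of_inverse w : braid_of (w ++ inverse_word w) = braid_one.
Proof.
elim: w => [//|[i b] w IHw].
have -> : ((i, b) :: w) ++ inverse_word ((i, b) :: w) =
    [:: (i, b)] ++ (w ++ inverse_word w) ++ [:: (i, ~~ b)].
  by rewrite {1}/inverse_word /= rev_cons -cats1 !catA.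
by rewrite -braid_mulE -(braid_mulE (w ++ _)) IHw braid_mul1 braid_mulE braid_cancel.
Qed.

Lemma braid_mulV : right_inverse braid_one braid_inv braid_mul.
Proof.
move=> x; rewrite -{1}[x]braid_of_repr braid_mulE; exact: braid_of_inverse.
Qed.

Lemma braid_Vmul : left_inverse braid_one braid_inv braid_mul.
Proof.
move=> x; rewrite -{2}[x]braid_of_repr braid_mulE.
by rewrite -{2}[repr x]inverse_wordK braid_of_inverse.
Qed.

End BraidGroup.

HB.instance Definition _ n := isGroup.Build (braid n)
  (@braid_mulA n) (@braid_mul1 n) (@braid_1mul n)
  (@braid_Vmul n) (@braid_mulV n).

(* The strands of the braid point upwards; the closing arcs run to its right. *)
Definition closure_cups (n : nat) : seq event :=
  [seq (i, Cup true) | i <- iota 0 n].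
Definition closure_caps (n : nat) : seq event :=
  rev [seq (i, Cap) | i <- iota 0 n].
Definition braid_events (n : nat) (w : braid_word n) : seq event :=
  [seq (nat_of_ord a.1, Cross a.2) | a <- w].
Definition closure_events (n : nat) (w : braid_word n) : seq event :=
  closure_cups n ++ braid_events w ++ closure_caps n.

Lemma run_cat w s t : run w (s ++ t) = obind (run^~ t) (run w s).
Proof. by elim: s w => //= x s IHs w; case: (step w x). Qed.

Definition closure_strands (n : nat) : seq bool := nseq n true ++ nseq n false.

Lemma run_closure_cups n : run [::] (closure_cups n) = Some (closure_strands n).
Proof.
elim: n => [//|n IHn].
rewrite /closure_cups -addn1 iotaD map_cat run_cat -/(closure_cups n) IHn /=.
rewrite /closure_strands size_cat !size_nseq leq_addr.
rewrite take_size_cat ?size_nseq // drop_size_cat ?size_nseq //.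
by rewrite addn1 -[n.+1]addn1 nseqD -catA /= addn1.
Qed.

Lemma run_closure_caps n : run (closure_strands n) (closure_caps n) = Some [::].
Proof.
elim: n => [//|n IHn].
rewrite /closure_caps -addn1 iotaD map_cat rev_cat /= addn1.
have -> : closure_strands n.+1 = nseq n true ++ true :: false :: nseq n false.
  by rewrite /closure_strands -[n.+1 in X in X ++ _]addn1 nseqD -catA.
by rewrite drop_size_cat ?size_nseq // take_size_cat ?size_nseq.
Qed.

Lemma run_braid_events n (w : braid_word n) :
  run (closure_strands n) (braid_events w) = Some (closure_strands n).
Proof.
elim: w => [//|[i b] w IHw] /=.
have hi : 1 + i < n by rewrite -ltn_subRL subn1.
rewrite add1n in hi.
have E m : nseq n true ++ m = nseq i true ++ true :: true :: nseq (n - i.+2) true ++ m.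
  by rewrite -{1}(subnKC hi) -addn2 -addnA nseqD -catA.
rewrite /closure_strands E drop_size_cat ?size_nseq //.
by rewrite take_size_cat ?size_nseq // -E.
Qed.

Lemma closure_eventsP n (w : braid_word n) :
  run [::] (closure_events w) == Some [::].
Proof.
by rewrite !run_cat run_closure_cups /= run_cat run_braid_events /= run_closure_caps.
Qed.

Definition closure_diagram (n : nat) (w : braid_word n) : link_diagram :=
  LinkDiagram (closure_eventsP w).

Definition closure (n : nat) (x : braid n) : oriented_link :=
  link_of (closure_diagram (repr x)).

Lemma closure_braid_move n (u v : braid_word n) :
  braid_move u v -> isotopic (closure_diagram u) (closure_diagram v).
Proof.
case=> c [m [m' [d [mm' -> ->]]]]; apply: rst_step.
exists (closure_cups n ++ braid_events c), (braid_events m), (braid_events m').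
exists (braid_events d ++ closure_caps n); split; last 2 first.
- by rewrite /= /closure_events /braid_events !map_cat !catA.
- by rewrite /= /closure_events /braid_events !map_cat !catA.
case: mm' => {m m'} [i b|i j ij|i j ij] /=.
- exact: R2.
- have := @Far i (j - i.+2) (Cross true) (Cross true).
  by rewrite /= addn2 subnKC.
- by rewrite -ij; exact: R3.
Qed.

Lemma closure_braid_of n (w : braid_word n) :
  closure (braid_of w) = link_of (closure_diagram w).
Proof.
apply/link_ofP; have /braid_ofP := braid_of_repr (braid_of w).
move: (repr _) => u0; elim=> {u0 w} [u v /closure_braid_move|u|u v _|u v w _ + _] //.
- exact: rst_refl.
- exact: rst_sym.
- exact: rst_trans.
Qed.

(* Integral Laurent polynomials in two variables [v] and [z], as the group ring
   of Z^2: the coefficient of [v ^ k.1 * z ^ k.2] in [p] is [p@_k].  The products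
   provided by monalg do not apply, as they exclude invertible monomials. *)
Definition laurent := {malg int[(int * int)%type]}.
HB.instance Definition _ := GRing.Zmodule.on laurent.

Local Open Scope ring_scope.

Section LaurentRing.
Implicit Types (p q r : laurent) (k l : int * int).

Definition laurent_mono k : laurent := mkmalgU k 1.

Definition laurent_mul p q : laurent :=
  \sum_(k <- msupp p) \sum_(l <- msupp q) mkmalgU (k + l) (p@_k * q@_l).

Lemma laurent_mulw (d e : {fset (int * int)}) p q :
  (msupp p `<=` d)%fset -> (msupp q `<=` e)%fset ->
  laurent_mul p q = \sum_(k <- d) \sum_(l <- e) mkmalgU (k + l) (p@_k * q@_l).
Proof.
move=> pd qe; rewrite /laurent_mul (big_fset_incl _ pd) /=; last first.
  by move=> k _ /mcoeff_outdom pk; rewrite big1 // => l _; rewrite pk mul0r monalgU0.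
apply/eq_bigr => k _; apply/big_fset_incl => // l _ /mcoeff_outdom ->.
by rewrite mulr0 monalgU0.
Qed.

Lemma laurent_mulC : commutative laurent_mul.
Proof.
move=> p q; rewrite /laurent_mul exchange_big /=.
by apply/eq_bigr => k _; apply/eq_bigr => l _; rewrite addrC mulrC.
Qed.

Lemma laurent_mulUU a b k l :
  laurent_mul (mkmalgU k a) (mkmalgU l b) = mkmalgU (k + l) (a * b).
Proof.
by rewrite (laurent_mulw msuppU_le msuppU_le) !big_seq_fset1 !mcoeffUU.
Qed.

Lemma laurent_mulDl : left_distributive laurent_mul +%R.
Proof.
move=> p q r; have rr := fsubset_refl (msupp r).
rewrite (laurent_mulw (msuppD_le p q) rr).
rewrite (laurent_mulw (fsubsetUl (msupp p) (msupp q)) rr).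
rewrite (laurent_mulw (fsubsetUr (msupp p) (msupp q)) rr).
rewrite -big_split /=; apply/eq_bigr => k _.
rewrite -big_split /=; apply/eq_bigr => l _.
by rewrite mcoeffD mulrDl monalgUD.
Qed.

Lemma laurent_mul0 p : laurent_mul 0 p = 0.
Proof. by rewrite /laurent_mul msupp0 big_seq_fset0. Qed.

Lemma laurent_mul_suml (I : Type) (s : seq I) (F : I -> laurent) q :
  laurent_mul (\sum_(i <- s) F i) q = \sum_(i <- s) laurent_mul (F i) q.
Proof.
by apply: (big_morph (laurent_mul^~ q)) => [p r|]; rewrite (laurent_mulDl, laurent_mul0).
Qed.

Lemma laurent_mul_sumr (I : Type) (s : seq I) (F : I -> laurent) q :
  laurent_mul q (\sum_(i <- s) F i) = \sum_(i <- s) laurent_mul q (F i).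
Proof.
by rewrite laurent_mulC laurent_mul_suml; apply/eq_bigr => i _; apply: laurent_mulC.
Qed.

Lemma laurent_mulA : associative laurent_mul.
Proof.
move=> p q r; rewrite [p]monalgE.
rewrite [LHS]laurent_mul_suml [X in _ = laurent_mul X _]laurent_mul_suml.
rewrite [RHS]laurent_mul_suml; apply/eq_bigr => k _; rewrite [q]monalgE.
rewrite [X in laurent_mul _ X = _]laurent_mul_suml.
rewrite [X in _ = laurent_mul X _]laurent_mul_sumr.
rewrite [LHS]laurent_mul_sumr [RHS]laurent_mul_suml; apply/eq_bigr => l _.
rewrite [r]monalgE [X in laurent_mul _ X = _]laurent_mul_sumr.
rewrite [LHS]laurent_mul_sumr [RHS]laurent_mul_sumr; apply/eq_bigr => m _.
by rewrite !laurent_mulUU addrA mulrA.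
Qed.

Lemma laurent_mul1 : left_id (laurent_mono 0) laurent_mul.
Proof.
move=> p; rewrite [p]monalgE laurent_mul_sumr; apply/eq_bigr => k _.
by rewrite laurent_mulUU add0r mul1r.
Qed.

Lemma laurent_1neq0 : laurent_mono 0 != 0.
Proof. by rewrite monalgU_eq0. Qed.

HB.instance Definition _ := GRing.Zmodule_isComNzRing.Build laurent
  laurent_mulA laurent_mulC laurent_mul1 laurent_mulDl laurent_1neq0.

End LaurentRing.

Definition laurent_v : laurent := laurent_mono (1, 0).
Definition laurent_z : laurent := laurent_mono (0, 1).

Definition laurent_eval (F : fieldType) (a b : F) (p : laurent) : F :=
  \sum_(k <- msupp p) (p@_k)%:~R * a ^ k.1 * b ^ k.2.

(* Up to the value on the empty link, which is not constrained here, exactly one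
   function satisfies this property: the Homflypt polynomial. *)
Definition is_homflypt (P : oriented_link -> laurent) : Prop :=
  P (link_of unknot_diagram) = 1 /\
  forall Dp D0 Dm : link_diagram, skein_triple Dp D0 Dm ->
    P (link_of Dp) =
      laurent_v * laurent_z * P (link_of D0) + laurent_v ^+ 2 * P (link_of Dm).

(* Jones polynomials are compared in the fraction field Q(t^(1/2)) of Z[t^(1/2)],
   where v = t and z = t^(1/2) - t^(-1/2) make sense. *)
Definition sqrt_t : {fraction {poly int}} := tofrac 'X.

Definition jones (P : oriented_link -> laurent) (L : oriented_link) :
    {fraction {poly int}} :=
  laurent_eval (sqrt_t ^+ 2) (sqrt_t - sqrt_t^-1) (P L).

(* Main.v *)
From Stdlib Require Import Relations.
From mathcomp Require Import all_boot all_order all_algebra.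
From mathcomp Require Import spectral algC cyclotomic.
From mathcomp Require Import finmap boolp monalg.
From mathcomp Require Import ring zify.
Require Import Defs.

(** Let [s1] and [s2] be the generators of the braid group, [e] the exponent sum of a braid,
    and divide the Homflypt polynomial of its closure by [v ^ e]. The skein relation becomes
    the relation [s - s^-1 = z], so the quotient is a linear functional on the Hecke algebra
    of the symmetric group on three letters, which is spanned by six braids. Markov
    destabilization leaves three free values, those on [1], [s1] and [s1 * s2], and each
    braid has three coordinates in [Z[z]] that do not depend on the functional
    ([expandable_braid]). The three irreducible characters of the algebra, [x ^ e] and
    [(- x^-1) ^ e], where [z = x - x^-1], and the trace [chi] of the Burau representation,
    are functionals of the same kind. They separate the coordinates, so the Homflypt
    polynomial of the closure is determined by [e] and [chi] ([homflypt_determined]). For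
    the Jones polynomial, with [t = x^2], they give the formula
    [V = (- x) ^ e * (x^2 + x^-2) + x ^ (2 e) * chi] ([jones_formula]).

    Let two closures have the same Jones polynomial. If their exponent sums agree, then so do
    the traces, hence the Homflypt polynomials. Otherwise the exponent sums have the same
    parity, as the values at [x = 1] show ([same_jones_parity]); call them [e] and
    [e + 2 m] with [m > 0]. As [chi] is a polynomial in [z], it is invariant under
    [x |-> - x^-1], so there is a second equation between the two traces, and both of them
    can be computed from [e] and [m] ([same_jones_isolated]). Therefore it is enough to find
    one pair of closures with these exponent sums, equal Jones polynomials and equal Homflypt
    polynomials ([homflypt_same_pair]). For [m = 1] the braids [s1 ^ k * s2^-1] and
    [s1 ^ k * s2] with [k = e + 1] do, as both closures are the torus link of type [(2, k)];
    for [m = 2] and [e = -2] there are [s1^-1 * s2^-1] and [s1 * s2], which close up to the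
    unknot.

    No other [e] and [m] occur ([exponent_gap]). The formulas for the traces are quotients
    whose denominator vanishes at certain roots of unity, and the numerators must vanish there
    too; this restricts [e] modulo multiples of [m]. The value of one of the traces at a suitable
    root of unity then exceeds [2] in absolute value. This is impossible, as the root can be
    taken in the part of the unit circle where the Burau representation is unitary, and a
    unitary matrix of size two has trace at most [2] in absolute value. *)

Set Implicit Arguments.
Unset Strict Implicit.
Unset Printing Implicit Defensive.

Import Order.TTheory GRing.Theory Num.Theory.
Local Open Scope ring_scope.

(** * Isotopies of closed braids *)

Notation letter1 := (ord0 : 'I_3.-1).
Notation letter2 := (ord_max : 'I_3.-1).

Definition crossings1 (s : seq bool) : seq event := [seq (0, Cross b) | b <- s].

Lemma run_crossings1 s w :
  run [:: true, true & w] (crossings1 s) = Some [:: true, true & w].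
Proof. by elim: s => //= b s IHs. Qed.

Definition valid (s : seq event) := run [::] s == Some [::].

(** Isotopy at the level of event sequences: moves are performed on bare sequences, and the
    validity of each sequence is a separate computation of [run]. *)
Definition ev_isotopic (s t : seq event) :=
  exists (D E : link_diagram), [/\ isotopic D E, events D = s & events E = t].

Lemma ev_move (u m m' v : seq event) : local_move m m' ->
  valid (u ++ m ++ v) -> valid (u ++ m' ++ v) ->
  ev_isotopic (u ++ m ++ v) (u ++ m' ++ v).
Proof.
move=> mm' h h'; exists (LinkDiagram h), (LinkDiagram h'); split=> //.
by apply: rst_step; exists u, m, m', v.
Qed.

Lemma ev_refl s : valid s -> ev_isotopic s s.
Proof.
by move=> h; exists (LinkDiagram h), (LinkDiagram h); split=> //; apply: rst_refl.
Qed.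

Lemma ev_sym s t : ev_isotopic s t -> ev_isotopic t s.
Proof. by case=> D [E [h hD hE]]; exists E, D; split=> //; apply: rst_sym. Qed.

Lemma ev_trans t s r : ev_isotopic s t -> ev_isotopic t r -> ev_isotopic s r.
Proof.
case=> D [E [h hD hE]] [E' [G [h' hE' hG]]]; exists D, G; split=> //.
apply: rst_trans h _; suff -> : E = E' by [].
by apply: val_inj; rewrite /= hE hE'.
Qed.

Lemma ev_isotopicP (D E : link_diagram) :
  ev_isotopic D E -> link_of D = link_of E.
Proof.
case=> D' [E' [h hD hE]]; apply/link_ofP.
by rewrite -(val_inj hD : D' = D) -(val_inj hE : E' = E).
Qed.

Lemma run_cons w x s : run w (x :: s) = obind (run^~ s) (step w x).
Proof. by []. Qed.

(** A piece with at least two strands to its left slides past any number of crossings of the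
    two leftmost strands, by repeated use of [Far]. These strands are taken to point
    upwards, so that [run] is unaffected by the crossings. *)
Lemma ev_commute u v k e s w w' : run [::] u = Some [:: true, true & w] ->
    step [:: true, true & w] (k.+2, e) = Some [:: true, true & w'] ->
    run [:: true, true & w'] v = Some [::] ->
  ev_isotopic (u ++ crossings1 s ++ (k.+2, e) :: v)
              (u ++ (k.+2, e) :: crossings1 s ++ v).
Proof.
move=> hu he hv.
have run_u t : run [::] (u ++ t) = run [:: true, true & w] t by rewrite run_cat hu.
have run_e t : run [:: true, true & w] ((k.+2, e) :: t) = run [:: true, true & w'] t.
  by rewrite run_cons he.
have run_x a t w1 : run [:: true, true & w1] ((0, Cross a) :: t) =
  run [:: true, true & w1] t by [].
elim: s u hu run_u => [|a s IHs] u hu run_u.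
  by apply: ev_refl; rewrite /valid run_u run_e hv.
have hua : run [::] (rcons u (0, Cross a)) = Some [:: true, true & w].
  by rewrite -cats1 run_u.
have run_ua t : run [::] (rcons u (0, Cross a) ++ t) = run [:: true, true & w] t.
  by rewrite run_cat hua.
apply: (@ev_trans (u ++ [:: (0, Cross a); (k.+2, e)] ++ crossings1 s ++ v)).
  by have := IHs _ hua run_ua; rewrite -cats1 -!catA.
have := @Far 0 k (Cross a) e; rewrite add0n /= add2n => /ev_move; apply.
  by rewrite /valid run_u !cat_cons cat0s run_x run_e run_cat run_crossings1 /= hv.
by rewrite /valid run_u cat_cons run_e cat_cons cat0s run_x run_cat run_crossings1 /= hv.
Qed.

(** The closure of a braid on two strands, in the form in which it comes out of [markov]. *)
Definition closure2 (s : seq bool) : seq event :=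
  [:: (0, Cup true); (1, Cup true)] ++ crossings1 s ++ [:: (1, Cap); (0, Cap)].

Definition word1 (s : seq bool) : braid_word 3 := [seq (letter1, b) | b <- s].

Lemma closure_diagram_word1 p b q :
  events (closure_diagram (word1 p ++ (letter2, b) :: word1 q)) =
  [:: (0, Cup true); (1, Cup true)] ++ (2, Cup true) :: crossings1 p ++
  (1, Cross b) :: crossings1 q ++ [:: (2, Cap); (1, Cap); (0, Cap)].
Proof.
rewrite /= /closure_events /braid_events map_cat /= -!map_comp /=.
by rewrite -!catA.
Qed.

(** Markov destabilization. The third strand crosses the others only once: its cup slides up
    to that crossing and its cap slides down, the crossing turns into a kink, and the kink
    disappears. The words [p] and [q] meet without being moved past each other, so no
    conjugation of braids is needed. *)
Lemma markov p b q :
  ev_isotopic (closure_diagram (word1 p ++ (letter2, b) :: word1 q))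
              (closure2 (p ++ q)).
Proof.
rewrite closure_diagram_word1.
set C := [:: (0, Cup true); (1, Cup true)].
set c := [:: (1, Cap); (0, Cap)].
have hp : run [::] (C ++ crossings1 p) = Some [:: true; true; false; false].
  by rewrite run_cat /= run_crossings1.
have run_p t : run [::] (C ++ crossings1 p ++ t) = run [:: true; true; false; false] t.
  by rewrite catA run_cat hp.
pose u1 := C ++ crossings1 p ++ [:: (1, Cup true)].
have hu1 : run [::] u1 = Some [:: true; true; false; true; false; false].
  by rewrite run_p.
(* The innermost cup rises to the crossing. *)
apply: (@ev_trans (C ++ crossings1 p ++
    (2, Cup true) :: (1, Cross b) :: crossings1 q ++ (2, Cap) :: c)).
  apply: ev_sym.
  apply: (@ev_commute C _ 0 _ _ [:: false; false] [:: true; false; false; false]) => //=.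
  by rewrite run_cat run_crossings1.
(* The crossing moves over to the other leg of the cup. *)
apply: (@ev_trans (C ++ crossings1 p ++
    (1, Cup true) :: (2, Cross (~~ b)) :: crossings1 q ++ (2, Cap) :: c)).
  have := @ev_move (C ++ crossings1 p) _ _ (crossings1 q ++ (2, Cap) :: c) (SlideCup 1 true b).
  rewrite -!catA /valid !run_p => h; apply: h; by rewrite /= run_cat run_crossings1.
(* It rises to the innermost cap. *)
apply: (@ev_trans (C ++ crossings1 p ++
    (1, Cup true) :: crossings1 q ++ (2, Cross (~~ b)) :: (2, Cap) :: c)).
  have := @ev_commute u1 ((2, Cap) :: c) 0 (Cross (~~ b)) q _ [:: true; false; false; false] hu1.
  by rewrite /u1 -!catA => h; apply/ev_sym/h.
(* Cup and cap now belong together: the cap absorbs the crossing, descends to the cup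
   and forms a zigzag with it. *)
apply: (@ev_trans (C ++ crossings1 p ++ (1, Cup true) :: crossings1 q ++ (2, Cap) :: c)).
  have := @ev_move (u1 ++ crossings1 q) _ _ c (R1Cap 2 (~~ b)).
  rewrite /u1 -!catA /valid !run_p => h; apply: h; by rewrite /= run_cat run_crossings1.
apply: (@ev_trans (C ++ crossings1 p ++ (1, Cup true) :: (2, Cap) :: crossings1 q ++ c)).
  have := @ev_commute u1 c 0 Cap q _ [:: false; false] hu1.
  by rewrite /u1 -!catA => h; apply/h.
have := @ev_move (C ++ crossings1 p) _ _ (crossings1 q ++ c) (ZigzagL 1 true).
rewrite -!catA /valid !run_p /closure2 /crossings1 map_cat -!catA => h; apply: h;
  by rewrite /= run_cat run_crossings1.
Qed.

Lemma closure2_unknot b : ev_isotopic (closure2 [:: b]) unknot_diagram.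
Proof.
apply: (@ev_trans [:: (0, Cup true); (0, Cup true); (1, Cross (~~ b)); (1, Cap); (0, Cap)]).
  exact: (@ev_move [:: (0, Cup true)] _ _ [:: (1, Cap); (0, Cap)] (SlideCup 0 true b)).
apply: (@ev_trans [:: (0, Cup true); (0, Cup true); (1, Cap); (0, Cap)]).
  exact: (@ev_move [:: (0, Cup true); (0, Cup true)] _ _ [:: (0, Cap)] (R1Cap 1 (~~ b))).
exact: (@ev_move [:: (0, Cup true)] _ _ [:: (0, Cap)] (ZigzagL 0 true)).
Qed.

(** The strands of a closed braid point upwards at its letters, so changing a letter into
    its inverse is changing a positive crossing, and deleting it is smoothing. *)
Lemma skein_closure n (i : 'I_n.-1) (u w : braid_word n) :
  skein_triple (closure_diagram (u ++ (i, true) :: w)) (closure_diagram (u ++ w))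
               (closure_diagram (u ++ (i, false) :: w)).
Proof.
have hi : (i.+2 <= n)%N by have := ltn_ord i; case: (n) i => [[]|m i].
exists (closure_cups n ++ braid_events u), (braid_events w ++ closure_caps n).
exists (nseq i true), (nseq (n - i.+2) true ++ nseq n false), true, true.
rewrite size_nseq /= /closure_events /braid_events !map_cat -!catA; split=> //.
rewrite run_cat run_closure_cups /= run_braid_events /closure_strands.
by rewrite -{1}(subnKC hi) -addn2 -addnA nseqD -catA.
Qed.

(** * The braid group on three strands *)

Section BraidThree.
Local Open Scope group_scope.

Definition sigma (i : 'I_3.-1) : braid 3 := braid_of [:: (i, true)].
Notation s1 := (sigma letter1).
Notation s2 := (sigma letter2).

Lemma braid_of_cat u w : braid_of (u ++ w) = braid_of u * braid_of w :> braid 3.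
Proof. by rewrite -braid_mulE. Qed.

Lemma sigmaV i : (sigma i)^-1 = braid_of [:: (i, false)].
Proof.
rewrite -[LHS]mulg1; apply: (mulgI (sigma i)); rewrite mulgA mulgV mul1g.
by rewrite /sigma -braid_of_cat /= braid_cancel.
Qed.

Lemma braid_of_cons i b w :
  braid_of ((i, b) :: w) = (if b then sigma i else (sigma i)^-1) * braid_of w.
Proof. by rewrite -cat1s braid_of_cat; case: b; rewrite ?sigmaV. Qed.

Lemma artin : s1 * s2 * s1 = s2 * s1 * s2.
Proof.
rewrite /sigma -!braid_of_cat /=; apply/braid_ofP/rst_step.
by exists [::], [:: (letter1, true); (letter2, true); (letter1, true)],
  [:: (letter2, true); (letter1, true); (letter2, true)], [::]; split; first constructor.
Qed.

Lemma braid_ind (K : braid 3 -> Prop) : K 1 ->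
  (forall i x, K x -> K (sigma i * x)) -> (forall i x, K x -> K ((sigma i)^-1 * x)) ->
  forall x, K x.
Proof.
move=> K1 KS KV x; have [w ->] := braid_ofE x; elim: w => [//|[i b] w IHw].
by rewrite braid_of_cons; case: b; [exact: KS | exact: KV].
Qed.

End BraidThree.

(** * Traces on the Hecke algebra *)

(** Integral polynomials have values in every commutative ring; here the variable stands for
    the skein variable [z]. *)
Definition intpoly_eval (R : comNzRingType) (z : R) (f : {poly int}) : R :=
  (map_poly intr f).[z].

Notation s1 := (sigma letter1).
Notation s2 := (sigma letter2).
Notation ratfrac := {fraction {poly int}}.
Notation hecke_coords := ({poly int} * {poly int} * {poly int})%type.
(** The Hecke relation with [z = x - x^-1] has the roots [x] and [- x^-1]. *)
Notation eval_z x f := (intpoly_eval (x - x^-1) f).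

Section IntpolyEval.
Variables (R : comNzRingType) (z : R).
Lemma evalD f g : intpoly_eval z (f + g) = intpoly_eval z f + intpoly_eval z g.
Proof. by rewrite /intpoly_eval rmorphD hornerD. Qed.
Lemma evalM f g : intpoly_eval z (f * g) = intpoly_eval z f * intpoly_eval z g.
Proof. by rewrite /intpoly_eval rmorphM hornerM. Qed.
Lemma evalX : intpoly_eval z 'X = z.
Proof. by rewrite /intpoly_eval map_polyX hornerX. Qed.
Lemma evalC (c : int) : intpoly_eval z c%:P = c%:~R.
Proof. by rewrite /intpoly_eval map_polyC hornerC. Qed.
Lemma eval0 : intpoly_eval z 0 = 0.
Proof. by rewrite -polyC0 evalC. Qed.
Lemma eval1 : intpoly_eval z 1 = 1.
Proof. by rewrite -polyC1 evalC. Qed.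
Lemma evalN f : intpoly_eval z (- f) = - intpoly_eval z f.
Proof. by rewrite /intpoly_eval rmorphN hornerN. Qed.
Lemma evalB f g : intpoly_eval z (f - g) = intpoly_eval z f - intpoly_eval z g.
Proof. by rewrite evalD evalN. Qed.
Definition evalE := (evalD, evalM, evalX, evalC, eval0, eval1, evalN).
End IntpolyEval.

(** Linear functionals on the Hecke algebra of the symmetric group on three letters, with
    quadratic relation [s - s^-1 = z], written as functions on the braid group. The last
    three fields are the instances of invariance under conjugation that reduce such a
    functional to its values on [1], [s1] and [s1 * s2]. *)
Record hecke_trace (R : comNzRingType) (z : R) (G : braid 3 -> R) : Prop := HeckeTrace {
  hecke_skein i x y : G (x * sigma i * y)%g = z * G (x * y)%g + G (x * (sigma i)^-1 * y)%g;
  hecke_s2 : G s2 = G s1;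
  hecke_s2s1 : G (s2 * s1)%g = G (s1 * s2)%g;
  hecke_s1s2s1 : G (s1 * s2 * s1)%g = G (s1 * s1 * s2)%g }.

(** One expansion serves all rings and all traces at once: this makes it possible to read
    off the coordinates of a braid from well-chosen characters and to use them for link
    invariants. *)
Definition expands (x : braid 3) (c : hecke_coords) :=
  forall (R : comNzRingType) (z : R) G, hecke_trace z G ->
    G x = intpoly_eval z c.1.1 * G 1%g + intpoly_eval z c.1.2 * G s1
          + intpoly_eval z c.2 * G (s1 * s2)%g.

Definition expandable x := exists c, expands x c.

Lemma expandable_comb (p q : {poly int}) x y u : expandable x -> expandable y ->
  (forall (R : comNzRingType) (z : R) G, hecke_trace z G ->
     G u = intpoly_eval z p * G x + intpoly_eval z q * G y) -> expandable u.
Proof.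
case=> [[[f g] h] /= X] [[[f' g'] h'] /= Y] E.
exists (p * f + q * f', p * g + q * g', p * h + q * h') => R z G hG /=.
rewrite (E _ _ _ hG) (X _ _ _ hG) (Y _ _ _ hG) /= !evalE; ring.
Qed.

(** The relation [s^2 = z s + 1]. *)
Lemma expandable_quadratic i x y : expandable (x * sigma i * y)%g ->
  expandable (x * y)%g -> expandable (x * sigma i * sigma i * y)%g.
Proof.
move=> h h'; apply: (expandable_comb (p := 'X) (q := 1) h h') => R z G hG.
by rewrite !evalE (hecke_skein hG) mulgK mul1r.
Qed.

Lemma expandable_inverse i x y : expandable (x * sigma i * y)%g ->
  expandable (x * y)%g -> expandable (x * (sigma i)^-1 * y)%g.
Proof.
move=> h h'; apply: (expandable_comb (p := 1) (q := - 'X) h h') => R z G hG.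
by rewrite !evalE (hecke_skein hG); ring.
Qed.

(** The positive permutation braids, which span the Hecke algebra. *)
Definition hecke_basis : seq (braid 3) :=
  [:: 1%g; s1; s2; (s1 * s2)%g; (s2 * s1)%g; (s1 * s2 * s1)%g].

Lemma expandable_basis b : b \in hecke_basis -> expandable b.
Proof.
have r1 : expandable 1%g by exists (1, 0, 0) => R z G _; rewrite !evalE; ring.
have r2 : expandable s1 by exists (0, 1, 0) => R z G _; rewrite !evalE; ring.
have r3 : expandable (s1 * s2)%g by exists (0, 0, 1) => R z G _; rewrite !evalE; ring.
have r4 : expandable s2.
  by exists (0, 1, 0) => R z G hG; rewrite !evalE (hecke_s2 hG); ring.
rewrite !inE => /or4P[/eqP->|/eqP->|/eqP->|/or3P[/eqP->|/eqP->|/eqP->]] //.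
  by exists (0, 0, 1) => R z G hG; rewrite !evalE (hecke_s2s1 hG); ring.
apply: (expandable_comb (p := 'X) (q := 1) r3 r4) => R z G hG.
rewrite !evalE mul1r (hecke_s1s2s1 hG) (hecke_skein hG letter1 s1 s2).
by rewrite mulgV mul1g.
Qed.

(** Right multiplication by a generator maps a basis element to another one, up to the braid
    relation, or else to a square, which the quadratic relation removes. *)
Lemma expandable_mul_sigma i x :
  (forall b, b \in hecke_basis -> expandable (b * x)%g) ->
  forall b, b \in hecke_basis -> expandable (b * sigma i * x)%g.
Proof.
move=> H.
have r1 : expandable x by rewrite -[x]mul1g; apply: H; rewrite !inE eqxx.
have r2 : expandable (s1 * x)%g by apply: H; rewrite !inE eqxx !orbT.
have r3 : expandable (s2 * x)%g by apply: H; rewrite !inE eqxx !orbT.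
have r4 : expandable (s1 * s2 * x)%g by apply: H; rewrite !inE eqxx !orbT.
have r5 : expandable (s2 * s1 * x)%g by apply: H; rewrite !inE eqxx !orbT.
have r6 : expandable (s1 * s2 * s1 * x)%g by apply: H; rewrite !inE eqxx !orbT.
have sq j y : expandable (y * sigma j * x)%g -> expandable (y * x)%g ->
    expandable (y * sigma j * sigma j * x)%g.
  exact: expandable_quadratic.
have [->|->] : i = letter1 \/ i = letter2.
  by case: i => -[|[|//]] hi; [left|right]; apply: val_inj.
all: move=> b; rewrite !inE => /or4P[/eqP->|/eqP->|/eqP->|/or3P[/eqP->|/eqP->|/eqP->]];
  rewrite ?mul1g //.
- by have := @sq letter1 1%g; rewrite !mul1g; apply.
- exact: sq.
- exact: sq.
- by have := @sq letter2 1%g; rewrite !mul1g; apply.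
- exact: sq.
- by rewrite -artin.
- by rewrite artin; apply: sq => //; rewrite -artin.
Qed.

(** The basis spans a subspace that contains [1] and is stable under the generators and their
    inverses, hence contains all braids. *)
Lemma expandable_braid x : expandable x.
Proof.
suff H b : b \in hecke_basis -> expandable (b * x)%g.
  by rewrite -[x]mul1g; apply: H; rewrite !inE eqxx.
elim/braid_ind: x b => [b hb|i x IHx b hb|i x IHx b hb].
  by rewrite mulg1; apply: expandable_basis.
  by rewrite mulgA; apply: expandable_mul_sigma.
by rewrite mulgA; apply: expandable_inverse; [apply: expandable_mul_sigma|apply: IHx].
Qed.

(** * Exponent sum and evaluation of braids *)

(** Values of letters in a monoid that satisfy the braid relations extend to a morphism from
    the braid group; this yields both the exponent sum and the Burau representation. *)
Section BraidEvaluation.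
Variables (T : Type) (idx : T) (op : Monoid.law idx) (phi : 'I_3.-1 -> bool -> T).

Definition braid_rep (x : braid 3) : T := \big[op/idx]_(a <- repr x) phi a.1 a.2.

Hypothesis phiV : forall i b, op (phi i b) (phi i (~~ b)) = idx.
Hypothesis phi_artin :
  op (phi letter1 true) (op (phi letter2 true) (phi letter1 true)) =
  op (phi letter2 true) (op (phi letter1 true) (phi letter2 true)).

Lemma braid_rep_of w : braid_rep (braid_of w) = \big[op/idx]_(a <- w) phi a.1 a.2.
Proof.
have /braid_ofP := braid_of_repr (braid_of w); rewrite /braid_rep.
move: (repr _) => u0; elim=> {u0 w} [u v|u|u v _|u v w _ -> _ ->] //.
case=> c [m [m' [d [mm' -> ->]]]]; rewrite !big_cat; congr (op _ (op _ _)).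
case: mm' => {m m'} [i b|i j ij|i j ij].
- by rewrite !big_cons !big_nil Monoid.mulm1 phiV.
- by case: i j ij => [[|[|//]] hi] [[|[|//]] hj].
- rewrite !big_cons !big_nil !Monoid.mulm1 /=.
  have [-> ->] : i = letter1 /\ j = letter2.
    by case: i j ij => [[|[|//]] hi] [[|[|//]] hj] //= _; split; apply: val_inj.
  exact: phi_artin.
Qed.

Lemma braid_repM x y : braid_rep (x * y)%g = op (braid_rep x) (braid_rep y).
Proof.
have [u ->] := braid_ofE x; have [w ->] := braid_ofE y.
by rewrite -braid_of_cat !braid_rep_of big_cat.
Qed.

Lemma braid_rep1 : braid_rep 1%g = idx.
Proof. by rewrite (braid_rep_of [::]) big_nil. Qed.

Lemma braid_rep_sigma i : braid_rep (sigma i) = phi i true.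
Proof. by rewrite braid_rep_of big_seq1. Qed.

Lemma braid_rep_sigmaV i : braid_rep (sigma i)^-1%g = phi i false.
Proof. by rewrite sigmaV braid_rep_of big_seq1. Qed.

End BraidEvaluation.

Definition exponent : braid 3 -> int :=
  braid_rep +%R (fun _ b => if b then 1 else - 1).

Section Exponent.
Let phiV (i : 'I_3.-1) (b : bool) : (if b then 1 else - 1 : int) + (if ~~ b then 1 else - 1) = 0.
Proof. by case: b. Qed.

Lemma exponent1 : exponent 1%g = 0.
Proof. exact: braid_rep1. Qed.
Lemma exponentM x y : exponent (x * y)%g = exponent x + exponent y.
Proof. exact: braid_repM. Qed.
Lemma exponent_sigma i : exponent (sigma i) = 1.
Proof. exact: braid_rep_sigma. Qed.
Lemma exponent_sigmaV i : exponent (sigma i)^-1%g = -1.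
Proof. exact: braid_rep_sigmaV. Qed.
Definition exponentE := (exponentM, exponent1, exponent_sigma, exponent_sigmaV).
End Exponent.

(** The one-dimensional characters of the Hecke algebra. Applied to [- x^-1] in place of
    [x], it gives the second one, with the same [z]. *)
Lemma hecke_power (K : fieldType) (x z : K) : x != 0 -> x - x^-1 = z ->
  hecke_trace z (fun b => x ^ exponent b).
Proof.
move=> x0 <-; split; rewrite ?exponentE // => i a b.
rewrite !exponentE !expfzDr // expr1z -[-1]/(- (1)) exprN1.
by set u := x ^ _; set v := x ^ _; field.
Qed.

Lemma laurent_monoM k l : laurent_mono k * laurent_mono l = laurent_mono (k + l).
Proof. by rewrite -[_ * _]/(laurent_mul _ _) laurent_mulUU mulr1. Qed.

Section LaurentEval.
Variables (F : fieldType) (a b : F).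
Hypotheses (a0 : a != 0) (b0 : b != 0).
Notation ev := (laurent_eval a b).
Implicit Types p q : laurent.

(** Any finite set of exponents containing the support can serve as index set, so that two
    polynomials can be summed over the same set. *)
Lemma laurent_evalw (d : {fset (int * int)}) p : (msupp p `<=` d)%fset ->
  ev p = \sum_(k <- d) (p@_k)%:~R * a ^ k.1 * b ^ k.2.
Proof.
move=> pd; rewrite /laurent_eval (big_fset_incl _ pd) //= => k _ /mcoeff_outdom ->.
by rewrite mulr0z !mul0r.
Qed.

Lemma laurent_evalU k (c : int) : ev (mkmalgU k c) = c%:~R * a ^ k.1 * b ^ k.2.
Proof. by rewrite (laurent_evalw msuppU_le) big_seq_fset1 mcoeffUU. Qed.

Lemma laurent_evalD p q : ev (p + q) = ev p + ev q.
Proof.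
rewrite (laurent_evalw (msuppD_le p q)).
rewrite (laurent_evalw (fsubsetUl (msupp p) (msupp q))).
rewrite (laurent_evalw (fsubsetUr (msupp p) (msupp q))).
rewrite -big_split /=; apply/eq_bigr => k _.
by rewrite mcoeffD mulrzDr !mulrDl.
Qed.

Lemma laurent_eval0 : ev 0 = 0.
Proof. by rewrite /laurent_eval msupp0 big_seq_fset0. Qed.

Lemma laurent_eval_sum (I : Type) (s : seq I) (f : I -> laurent) :
  ev (\sum_(i <- s) f i) = \sum_(i <- s) ev (f i).
Proof. exact: (big_morph _ laurent_evalD laurent_eval0). Qed.

Lemma laurent_evalM p q : ev (p * q) = ev p * ev q.
Proof.
rewrite -[p * q]/(laurent_mul p q) /laurent_mul laurent_eval_sum.
rewrite [X in _ = X * _]/laurent_eval mulr_suml.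
apply/eq_bigr => k _; rewrite laurent_eval_sum [X in _ = _ * X]/laurent_eval mulr_sumr.
apply/eq_bigr => l _; rewrite laurent_evalU /= intrM !expfzDr //; ring.
Qed.

Lemma laurent_eval_mono k : ev (laurent_mono k) = a ^ k.1 * b ^ k.2.
Proof. by rewrite laurent_evalU mul1r. Qed.

End LaurentEval.

(** * Homflypt and Jones polynomials as Hecke traces *)

Lemma closure_markov p b q p' b' q' : p ++ q = p' ++ q' ->
  closure (braid_of (word1 p ++ (letter2, b) :: word1 q)) =
  closure (braid_of (word1 p' ++ (letter2, b') :: word1 q')).
Proof.
move=> pq; rewrite !closure_braid_of; apply: ev_isotopicP.
by apply: ev_trans (markov p b q) _; rewrite pq; apply/ev_sym/markov.
Qed.

Lemma closure_unknot p b q c : p ++ q = [:: c] ->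
  closure (braid_of (word1 p ++ (letter2, b) :: word1 q)) = link_of unknot_diagram.
Proof.
move=> pq; rewrite closure_braid_of; apply: ev_isotopicP.
by apply: ev_trans (markov p b q) _; rewrite pq; apply: closure2_unknot.
Qed.

(** What the Homflypt and Jones polynomials of closed 3-braids have in common. The function
    [m] gives the powers of the variable [v], including the negative ones, in rings without
    an inversion operation; [zi] is an inverse of [z]. *)
Record closure_invariant (R : comNzRingType) (m : int -> R) (z zi : R)
    (H : braid 3 -> R) : Prop := ClosureInvariant {
  framing0 : m 0 = 1;
  framingD a b : m (a + b) = m a * m b;
  closure_zK : z * zi = 1;
  closure_skein i x y : H (x * sigma i * y)%g =
    m 1 * z * H (x * y)%g + m 1 ^+ 2 * H (x * (sigma i)^-1 * y)%g;
  closure_unknot12 b c : H (braid_of [:: (letter1, b); (letter2, c)]) = 1;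
  closure_unknot21 b c : H (braid_of [:: (letter2, b); (letter1, c)]) = 1;
  closure_s1s2s1 : H (s1 * s2 * s1)%g = H (s1 * s1 * s2)%g }.

(** Division by the power of [v] given by the exponent sum removes [v] from the skein
    relation and leaves the Hecke relation. *)
Definition framed (R : comNzRingType) (m : int -> R) (H : braid 3 -> R) b : R :=
  m (- exponent b) * H b.

Section ClosureInvariant.
Variables (R : comNzRingType) (m : int -> R) (z zi : R) (H : braid 3 -> R).
Hypothesis hH : closure_invariant m z zi H.

(** Changing the crossing of [s1 * s2] at the second letter gives an unknot again, and
    smoothing it gives [s1]: the value on the trivial link of two components follows from
    that on the unknot. The next lemmas argue in the same way. *)
Lemma value_s1 : m 1 * z * H s1 = 1 - m 1 ^+ 2.
Proof.
have := closure_skein hH letter2 s1 1%g; rewrite !mulg1 sigmaV /sigma -!braid_of_cat /=.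
by rewrite !(closure_unknot12 hH) mulr1 => ->; rewrite addrK.
Qed.

Lemma value_s2 : m 1 * z * H s2 = 1 - m 1 ^+ 2.
Proof.
have := closure_skein hH letter1 1%g s2; rewrite !mul1g sigmaV /sigma -!braid_of_cat /=.
by rewrite !(closure_unknot12 hH) mulr1 => ->; rewrite addrK.
Qed.

Lemma value_s1V : m 1 * z * H s1^-1%g = 1 - m 1 ^+ 2.
Proof.
have := closure_skein hH letter2 s1^-1%g 1%g.
rewrite !mulg1 !sigmaV /sigma -!braid_of_cat /=.
by rewrite !(closure_unknot12 hH) mulr1 => ->; rewrite addrK.
Qed.

Lemma value_1 : m 1 * z * H 1%g = H s1 - m 1 ^+ 2 * H s1^-1%g.
Proof.
by have := closure_skein hH letter1 1%g 1%g; rewrite !mulg1 !mul1g => ->; rewrite addrK.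
Qed.

Lemma value_s1s2 : H (s1 * s2)%g = 1.
Proof. by rewrite /sigma -!braid_of_cat /= (closure_unknot12 hH). Qed.

Lemma value_s2s1 : H (s2 * s1)%g = 1.
Proof. by rewrite /sigma -!braid_of_cat /= (closure_unknot21 hH). Qed.

Lemma framed_hecke : hecke_trace z (framed m H).
Proof.
have mD := framingD hH.
have m1K : m 1 * m (- 1) = 1 by rewrite -mD addrN (framing0 hH).
split=> [i x y|||]; rewrite /framed.
- rewrite (closure_skein hH) !exponentE !opprD !mD opprK.
  transitivity ((m 1 * m (-1)) * (m (- exponent x) * m (- exponent y) * z * H (x * y)%g) +
      (m 1 * m (-1)) *
      (m (- exponent x) * m 1 * m (- exponent y) * H (x * (sigma i)^-1 * y)%g)).
    by ring.
  by rewrite m1K; ring.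
- rewrite !exponentE; congr (_ * _).
  (* value_s1 and value_s2 agree, and m 1 * z is invertible. *)
  rewrite -[LHS]mul1r -[RHS]mul1r -m1K -[m 1]mul1r -(closure_zK hH).
  rewrite (_ : z * zi * m 1 * m (-1) * H s2 = zi * m (- 1) * (m 1 * z * H s2)); last by ring.
  by rewrite value_s2 -value_s1; ring.
- by rewrite !exponentE value_s1s2 value_s2s1.
- by rewrite !exponentE (closure_s1s2s1 hH).
Qed.

End ClosureInvariant.

Definition mono_v (a : int) : laurent := laurent_mono (a, 0).
Definition laurent_zV : laurent := laurent_mono (0, - 1).

Lemma mono_vD a b : mono_v (a + b) = mono_v a * mono_v b.
Proof. by rewrite /mono_v laurent_monoM; congr (laurent_mono (_, _)). Qed.

Lemma homflypt_skein P (hP : is_homflypt P) i (x y : braid 3) :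
  P (closure (x * sigma i * y)%g) =
  mono_v 1 * laurent_z * P (closure (x * y)%g) +
  mono_v 1 ^+ 2 * P (closure (x * (sigma i)^-1 * y)%g).
Proof.
have [u ->] := braid_ofE x; have [w ->] := braid_ofE y.
rewrite sigmaV /sigma -!braid_of_cat -!catA /= !closure_braid_of.
by case: hP => _; apply; apply: skein_closure.
Qed.

(** Where a trace would use invariance under conjugation, the two closures destabilize to
    the same closed 2-braid. *)
Lemma homflypt_invariant P : is_homflypt P ->
  closure_invariant mono_v laurent_z laurent_zV (fun b : braid 3 => P (closure b)).
Proof.
move=> hP; have [unknot _] := hP; split=> [|a b|||b c|b c|].
- by [].
- exact: mono_vD.
- by rewrite /laurent_z /laurent_zV laurent_monoM.
- exact: homflypt_skein.
- by rewrite (@closure_unknot [:: b] c [::] b).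
- by rewrite (@closure_unknot [::] b [:: c] c).
- rewrite /sigma -!braid_of_cat /=.
  by rewrite (@closure_markov [:: true] true [:: true] [:: true; true] true [::]).
Qed.

(** * Specialization of rational functions *)

Section Specialization.
Variables (K : fieldType) (x : K).
Hypothesis x0 : x != 0.

(** The fraction [u] is a Laurent polynomial in [sqrt_t], and [c] is its value when [sqrt_t]
    becomes [x]. As a relation closed under the ring operations, it transports identities
    between Laurent polynomials from the generic point to [x], even where denominators used
    in their proof vanish. *)
Definition specializes (u : ratfrac) (c : K) := exists (p : {poly int}) (n : nat),
  u * sqrt_t ^+ n = tofrac p /\ c * x ^+ n = intpoly_eval x p.

Lemma sqrt_t_neq0 : sqrt_t != 0.
Proof. by rewrite /sqrt_t tofrac_eq0 polyX_eq0. Qed.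

Lemma specializes_int (c : int) : specializes c%:~R c%:~R.
Proof.
exists c%:P, 0; rewrite !expr0 !mulr1 evalE; split=> //.
by rewrite -[in RHS](intz c) !rmorph_int.
Qed.

Lemma specializes0 : specializes 0 0. Proof. exact: (specializes_int 0). Qed.
Lemma specializes1 : specializes 1 1. Proof. exact: (specializes_int 1). Qed.

Lemma specializesX : specializes sqrt_t x.
Proof. by exists 'X, 0; rewrite !expr0 !mulr1 evalE. Qed.

Lemma specializesXV : specializes sqrt_t^-1 x^-1.
Proof. by exists 1, 1; rewrite !expr1 !mulVf ?sqrt_t_neq0 // evalE tofrac1. Qed.

Lemma specializesD u v c d :
  specializes u c -> specializes v d -> specializes (u + v) (c + d).
Proof.
case=> p [n [up cp]] [q [m [vq dq]]]; exists (p * 'X^m + q * 'X^n), (n + m)%N.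
rewrite !exprD !mulrDl tofracD !tofracM -up -vq !tofracXn -/sqrt_t.
rewrite evalD !evalM -cp -dq /intpoly_eval !map_polyXn !hornerXn.
by split; ring.
Qed.

Lemma specializesM u v c d :
  specializes u c -> specializes v d -> specializes (u * v) (c * d).
Proof.
case=> p [n [up cp]] [q [m [vq dq]]]; exists (p * q), (n + m)%N.
by rewrite !exprD tofracM -up -vq evalM -cp -dq; split; ring.
Qed.

Lemma specializesN u c : specializes u c -> specializes (- u) (- c).
Proof.
by move=> h; rewrite -mulN1r -[- c]mulN1r; apply/specializesM/h/(specializes_int (-1)).
Qed.

Lemma specializesXn u c n : specializes u c -> specializes (u ^+ n) (c ^+ n).
Proof.
move=> h; elim: n => [|n IHn]; first exact: specializes1.
by rewrite !exprS; apply: specializesM.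
Qed.

Lemma specializesXz (k : int) : specializes (sqrt_t ^ k) (x ^ k).
Proof.
case: k => n; first exact/specializesXn/specializesX.
by rewrite !NegzE -!exprz_inv; apply/specializesXn/specializesXV.
Qed.

Lemma specializes_sum n (f : nat -> ratfrac) (g : nat -> K) :
  (forall i, specializes (f i) (g i)) ->
  specializes (\sum_(i < n) f i) (\sum_(i < n) g i).
Proof.
move=> fg; elim: n => [|n IHn]; first by rewrite !big_ord0; exact: specializes0.
by rewrite !big_ord_recr; apply: specializesD.
Qed.

Lemma specializes_eval f u c :
  specializes u c -> specializes (intpoly_eval u f) (intpoly_eval c f).
Proof.
move=> h; elim/poly_ind: f => [|f a IHf]; first by rewrite !evalE; exact: specializes0.
rewrite !evalE; apply: specializesD; last exact: specializes_int.
exact: specializesM.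
Qed.

Lemma specializes_eq u c d : specializes u c -> specializes u d -> c = d.
Proof.
case=> p [n [up cp]] [q [m [uq dq]]].
have E : p * 'X^m = q * 'X^n.
  apply/eqP; rewrite -tofrac_eq !tofracM !tofracXn -/sqrt_t -up -uq.
  by apply/eqP; ring.
apply: (mulIf (expf_neq0 (n + m) x0)).
have := congr1 (intpoly_eval x) E; rewrite !evalM -cp -dq.
rewrite /intpoly_eval !map_polyXn !hornerXn exprD => h.
by rewrite mulrA h; ring.
Qed.

End Specialization.

Ltac specializing :=
  repeat first [ exact: specializesX | exact: specializesXV | exact: specializesXz
               | exact: specializes0 | exact: specializes1 | exact: specializes_int
               | assumption
               | apply: specializes_eval | apply: specializesN | apply: specializesXn
               | apply: specializesD | apply: specializesM ].

(** Every algebraic number [y] has the form [x - x^-1], so a polynomial that vanishes at the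
    generic value of [z] vanishes at every [y]. *)
Lemma eval_z_sqrt_t_eq0 f : eval_z sqrt_t f = 0 -> f = 0.
Proof.
move=> f0; have fv (y : algC) : intpoly_eval y f = 0.
  have [x hx] : exists x : algC, x ^+ 2 = \sum_(i < 2) [:: 1; y]`_i * x ^+ i.
    exact: (@solve_monicpoly algC 2 (nth 0 [:: 1; y])).
  move: hx; rewrite !big_ord_recl big_ord0 /= expr0 expr1 mulr1 addr0 => hx.
  have x0 : x != 0.
    apply: contra_eq_neq hx => ->; rewrite expr0n /= mulr0 addr0 eq_sym; exact: oner_neq0.
  have <- : x - x^-1 = y.
    by apply: (mulIf x0); rewrite mulrBl mulVf // -expr2 hx; ring.
  apply: (@specializes_eq _ x x0 0); last exact: specializes0.
  by rewrite -f0; specializing.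
apply: (map_inj_poly (f := intr : int -> algC)); rewrite ?map_poly0 //.
  exact: intr_inj.
apply: (@roots_geq_poly_eq0 _ _ [seq n%:R | n <- iota 0 (size f)]).
- by apply/allP => y _; apply/rootP/fv.
- by rewrite map_inj_uniq ?iota_uniq // => a b /eqP; rewrite eqr_nat => /eqP.
- by rewrite size_map size_iota; exact: size_poly.
Qed.

Lemma sqrt_t_expr_neq1 n : (0 < n)%N -> sqrt_t ^+ n != 1.
Proof.
move=> n0; rewrite /sqrt_t -tofracXn -tofrac1 tofrac_eq.
apply/eqP => /(congr1 (fun p : {poly int} => size p)).
by rewrite size_polyXn size_poly1; case: n n0.
Qed.

Lemma sqrt_t_sub_neq0 : sqrt_t - sqrt_t^-1 != 0.
Proof.
have x0 := sqrt_t_neq0; apply: contra_neq (@sqrt_t_expr_neq1 2 isT) => /eqP.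
by rewrite subr_eq0 => /eqP xV; rewrite expr2 {2}xV mulfV.
Qed.

(** Evaluation of Laurent polynomials is a ring morphism, so the Jones polynomial inherits
    the properties of the Homflypt polynomial. *)
Lemma jones_invariant P : is_homflypt P ->
  closure_invariant (fun a => (sqrt_t ^+ 2) ^ a) (sqrt_t - sqrt_t^-1)
    (sqrt_t - sqrt_t^-1)^-1 (fun b : braid 3 => jones P (closure b)).
Proof.
move=> /homflypt_invariant hP.
have x20 := expf_neq0 2 sqrt_t_neq0; have z0 := sqrt_t_sub_neq0.
pose ev := laurent_eval (sqrt_t ^+ 2) (sqrt_t - sqrt_t^-1).
have evM p q : ev (p * q) = ev p * ev q by exact: (laurent_evalM x20 z0 p q).
have ev1 : ev 1 = 1 by rewrite /ev (laurent_eval_mono _ _ 0) !expr0z mulr1.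
have evv : ev (mono_v 1) = (sqrt_t ^+ 2) ^ 1.
  by rewrite /ev laurent_eval_mono expr0z mulr1.
have evz : ev laurent_z = sqrt_t - sqrt_t^-1.
  by rewrite /ev laurent_eval_mono expr1z expr0z mul1r.
split=> [|a b||i a b|b c|b c|]; rewrite /jones -/ev.
- exact: expr0z.
- exact: (expfzDr _ _ x20).
- exact: (mulfV z0).
- by rewrite (closure_skein hP) /ev laurent_evalD -/ev expr2 !evM evv evz.
- by rewrite (closure_unknot12 hP).
- by rewrite (closure_unknot21 hP).
- by rewrite (closure_s1s2s1 hP).
Qed.

(** * The exponent sum and the Burau trace determine the polynomials *)

(** Each character of the Hecke algebra gives a linear equation between the coordinates;
    this is the one of [s |-> x], followed by the one of [s |-> - x^-1]. *)
Lemma expands_power (K : fieldType) (x : K) b c : x != 0 -> expands b c ->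
  x ^ exponent b = eval_z x c.1.1 + x * eval_z x c.1.2
   + x ^+ 2 * eval_z x c.2.
Proof.
move=> x0 hc; rewrite (hc _ _ _ (hecke_power x0 erefl)) !exponentE expr0z expr1z.
by rewrite -exprnP; ring.
Qed.

Lemma expands_powerV (K : fieldType) (x : K) b c : x != 0 -> expands b c ->
  (- x^-1) ^ exponent b = eval_z x c.1.1 - x^-1 * eval_z x c.1.2
   + x ^- 2 * eval_z x c.2.
Proof.
move=> x0 hc; have y0 : - x^-1 != 0 by rewrite oppr_eq0 invr_eq0.
have -> := expands_power y0 hc; rewrite invrN invrK opprK addrC sqrrN exprVn.
by rewrite [- _ + x]addrC; ring.
Qed.

(** The value of the expansion on the character of the two-dimensional representation, which
    is [2], [z] and [-1] on [1], [s1] and [s1 * s2]. *)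
Definition burau_trace (c : hecke_coords) : {poly int} := c.1.1 + c.1.1 + 'X * c.1.2 - c.2.

(** For [x = exp (i theta)] this is [2 cos (2 theta)]. *)
Definition twice_cos (K : fieldType) (x : K) : K := x ^+ 2 + x ^- 2.

(** The Jones polynomial of a closed 3-braid with exponent sum [e] and Burau trace [a],
    where [x^2 = t]. *)
Definition jones_expr (K : fieldType) (x : K) e (a : {poly int}) : K :=
  (- x) ^ e * twice_cos x + x ^ (e + e) * eval_z x a.

(** At [v = x^2] the weights of the three irreducible characters in the Markov trace are [0]
    for [s |-> x], [x^2 + x^-2] for [s |-> - x^-1], and [1] for the two-dimensional one.
    Both sides being traces, comparing the values on [1], [s1] and [s1 * s2] is enough. *)
Lemma skein_formula (K : fieldType) (x : K) (H : braid 3 -> K) b c :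
  x != 0 -> x - x^-1 != 0 ->
  closure_invariant (fun a => (x ^+ 2) ^ a) (x - x^-1) (x - x^-1)^-1 H ->
  expands b c -> H b = jones_expr x (exponent b) (burau_trace c).
Proof.
move=> x0 z0 hH hc; have z20 : x ^+ 2 - 1 != 0.
  have -> : x ^+ 2 - 1 = x * (x - x^-1) by field.
  by rewrite mulf_neq0.
have hJ := hc _ _ _ (framed_hecke hH); set m := (fun a => _) in hH hJ.
have m1 : m 1 = x ^+ 2 by rewrite /m expr1z.
have xz0 : m 1 * (x - x^-1) != 0 by rewrite m1 mulf_neq0 ?expf_neq0.
have Hs : H s1 = - (x + x^-1).
  by apply: (mulfI xz0); rewrite (value_s1 hH) m1; field.
have HsV : H s1^-1%g = - (x + x^-1).
  by apply: (mulfI xz0); rewrite (value_s1V hH) m1; field.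
have H1 : H 1%g = (x + x^-1) ^+ 2.
  by apply: (mulfI xz0); rewrite (value_1 hH) Hs HsV m1; field.
have Hss : H (s1 * s2)%g = 1 by exact: (value_s1s2 hH).
have mE a : m a = x ^ (a + a) by rewrite /m expr2 expfzMl expfzDr.
have -> : H b = x ^ (exponent b + exponent b) * framed m H b.
  by rewrite /framed mE mulrA -opprD -expfzDr // addrN mul1r.
have mx : (- x) ^ exponent b = x ^ (exponent b + exponent b) * (- x^-1) ^ exponent b.
  by rewrite expfzDr // -!expfzMl; congr (_ ^ _); field.
rewrite /jones_expr mx -mulrA -mulrDr (expands_powerV x0 hc) hJ; congr (_ * _).
rewrite /framed !mE H1 Hs Hss !exponentE /burau_trace /twice_cos.
rewrite !evalE.
rewrite oppr0 addr0 expr0z (_ : - 1 - 1 = - 2%:Z) // -!exprnN.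
rewrite (_ : - (1 + 1) + - (1 + 1) = - 4%:Z) // -!exprnN.
by field.
Qed.
Lemma jones_formula P (hP : is_homflypt P) b c : expands b c ->
  jones P (closure b) = jones_expr sqrt_t (exponent b) (burau_trace c).
Proof.
exact: skein_formula sqrt_t_neq0 sqrt_t_sub_neq0 (jones_invariant hP).
Qed.

(** The matrix of the values of the three irreducible characters on [1], [s1] and [s1 * s2]
    is invertible: adding the first two equations and subtracting the third leaves [(x^2 + 1
    + x^-2) d], then the difference of the first two leaves [(x + x^-1) b]. *)
Lemma hecke_coords_eq0 (K : fieldType) (x a b d : K) :
  x != 0 -> x ^+ 4 != 1 -> x ^+ 6 != 1 ->
  a + x * b + x ^+ 2 * d = 0 -> a - x^-1 * b + x ^- 2 * d = 0 ->
  a + a + (x - x^-1) * b - d = 0 -> [/\ a = 0, b = 0 & d = 0].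
Proof.
move=> x0 x4 x6 e1 e2 e3.
have d0 : d = 0.
  have : (x ^+ 6 - 1) * d = 0.
    transitivity (x ^+ 2 * (x ^+ 2 - 1) * ((a + x * b + x ^+ 2 * d) + (a - x^-1 * b + x ^- 2 * d) -
       (a + a + (x - x^-1) * b - d))); first by field.
    by rewrite e1 e2 e3; ring.
  by move/eqP; rewrite mulf_eq0 subr_eq0 (negPf x6) => /eqP.
have b0 : b = 0.
  have : (x ^+ 4 - 1) * b = 0.
    transitivity (x * (x ^+ 2 - 1) * ((a + x * b + x ^+ 2 * d) - (a - x^-1 * b + x ^- 2 * d))).
      by rewrite d0; field.
    by rewrite e1 e2; ring.
  by move/eqP; rewrite mulf_eq0 subr_eq0 (negPf x4) => /eqP.
by move: e1; rewrite b0 d0 !mulr0 !addr0.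
Qed.

Lemma hecke_coords_inj (K : fieldType) (x a b d a' b' d' : K) :
  x != 0 -> x ^+ 4 != 1 -> x ^+ 6 != 1 ->
  a + x * b + x ^+ 2 * d = a' + x * b' + x ^+ 2 * d' ->
  a - x^-1 * b + x ^- 2 * d = a' - x^-1 * b' + x ^- 2 * d' ->
  a + a + (x - x^-1) * b - d = a' + a' + (x - x^-1) * b' - d' ->
  [/\ a = a', b = b' & d = d'].
Proof.
move=> x0 x4 x6 /eqP e1 /eqP e2 /eqP e3.
rewrite -subr_eq0 in e1; rewrite -subr_eq0 in e2; rewrite -subr_eq0 in e3.
have [] := @hecke_coords_eq0 _ x (a - a') (b - b') (d - d') x0 x4 x6.
- by rewrite -[RHS](eqP e1); ring.
- by rewrite -[RHS](eqP e2); ring.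
- by rewrite -[RHS](eqP e3); ring.
by move=> /subr0_eq -> /subr0_eq -> /subr0_eq ->.
Qed.

Lemma eval_z_sqrt_t_inj f g :
  eval_z sqrt_t f = eval_z sqrt_t g -> f = g.
Proof.
move=> fg; apply/subr0_eq/eval_z_sqrt_t_eq0.
by rewrite evalB fg subrr.
Qed.

(** The exponent sum gives the two one-dimensional characters, so together with the Burau
    trace it gives all coordinates, and these determine every trace. *)
Lemma homflypt_determined P (hP : is_homflypt P) b b' c c' :
  expands b c -> expands b' c' -> exponent b = exponent b' ->
  eval_z sqrt_t (burau_trace c) =
    eval_z sqrt_t (burau_trace c') ->
  P (closure b) = P (closure b').
Proof.
move=> hc hc' ee ea; have x0 := sqrt_t_neq0.
have cc' : c = c'.
  have e1 := expands_power x0 hc; have e2 := expands_powerV x0 hc.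
  rewrite ee (expands_power x0 hc') in e1; rewrite ee (expands_powerV x0 hc') in e2.
  rewrite /burau_trace !evalD !evalM !evalN evalX in ea.
  have [] := hecke_coords_inj x0 (@sqrt_t_expr_neq1 4 isT) (@sqrt_t_expr_neq1 6 isT)
    (esym e1) (esym e2) ea.
  case: c c' {hc hc' e1 e2 ea} => [[f g] h] [[f' g'] h'] /=.
  by do 3![move/eval_z_sqrt_t_inj=> ->].
have hF := framed_hecke (homflypt_invariant hP).
have E : framed mono_v (fun d => P (closure d)) b = framed mono_v (fun d => P (closure d)) b'.
  by rewrite (hc _ _ _ hF) cc' -(hc' _ _ _ hF).
have unframe d : P (closure d) = mono_v (exponent d) * framed mono_v (fun d => P (closure d)) d.
  by rewrite /framed mulrA -mono_vD addrN mul1r.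
by rewrite !unframe ee E.
Qed.

(** * Unitarity of the Burau representation *)

Lemma unitary_trace_le n (M : 'M[algC]_n) : M \is unitarymx -> `|\tr M| <= n%:R.
Proof.
move/unitarymxP => h; apply: le_trans (ler_norm_sum _ _ _) _.
rewrite -[n in n%:R]card_ord -sum1_card natr_sum; apply: ler_sum => i _.
rewrite -(expr_le1 (n := 2)) // normCK.
have := congr1 (fun A : 'M[algC]_n => A i i) h; rewrite !mxE eqxx mulr1n => <-.
rewrite (bigD1 i) //= !mxE lerDl; apply: sumr_ge0 => j _; rewrite !mxE.
exact: mul_conjC_ge0.
Qed.

Definition mx2 (a b c d : algC) : 'M[algC]_2 :=
  \matrix_(i < 2, j < 2)
    if i == 0 then (if j == 0 then a else b) else (if j == 0 then c else d).

Lemma mx2M a b c d a' b' c' d' : mx2 a b c d *m mx2 a' b' c' d' =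
  mx2 (a * a' + b * c') (a * b' + b * d') (c * a' + d * c') (c * b' + d * d').
Proof.
apply/matrixP => i j; rewrite !mxE !big_ord_recl big_ord0 !mxE addr0 /=.
by case: i => -[|[|//]] hi; case: j => -[|[|//]] hj.
Qed.

Lemma mx2_tr a b c d : \tr (mx2 a b c d) = a + d.
Proof. by rewrite /mxtrace !big_ord_recl big_ord0 !mxE addr0. Qed.

Lemma mx2_1 : mx2 1 0 0 1 = 1%:M.
Proof.
apply/matrixP => i j; rewrite !mxE.
by case: i => -[|[|//]] hi; case: j => -[|[|//]] hj.
Qed.

(** For [x] on the unit circle the two-dimensional representation is unitary if the absolute
    value of [x + x^-1] is at least [1], as this bounds the diagonal entries of [s2]. The
    generator [s1] is diagonal with eigenvalues [x] and [- x^-1], and [s2] has rows [A, B]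
    and [B, D] with [B] real and [D] minus the conjugate of [A]; the entry [A] is determined
    by the trace [-1] of [s1 * s2], and [B] by the determinant [-1]. *)
Section Unitary.
Variables (x : algC).
Hypothesis x1 : `|x| = 1.
Hypothesis x2 : 1 <= `|x + x^-1|.

Let w := x + x^-1.
Let A := - x ^- 2 / w.
Let D := x ^+ 2 / w.
Let B := sqrtC (1 + A * D).

Let x0 : x != 0. Proof. by rewrite -normr_eq0 x1 oner_eq0. Qed.
Let w0 : w != 0. Proof. by rewrite -normr_gt0; apply: lt_le_trans x2. Qed.
Let xC : x^* = x^-1. Proof. by rewrite invC_norm x1 expr1n invr1 mul1r. Qed.
Let wC : w^* = w. Proof. by rewrite /w rmorphD /= fmorphV /= xC invrK addrC. Qed.
Let AC : A^* = - D.
Proof. by rewrite /A /D rmorphM rmorphN /= !fmorphV /= wC rmorphXn /= xC exprVn invrK mulNr. Qed.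
Let DC : D^* = - A.
Proof. by rewrite -[D]opprK -AC rmorphN /= conjCK. Qed.
Let BB : B * B = 1 + A * D. Proof. by rewrite -expr2 sqrtCK. Qed.
Let B_ge0 : 0 <= B.
Proof.
rewrite sqrtC_ge0.
have -> : A * D = - (`|w| ^+ 2)^-1 by rewrite normCK wC /A /D; clearbody w; field; rewrite w0 x0.
rewrite subr_ge0 invf_le1 ?exprn_gt0 ?normr_gt0 //.
exact: exprn_ege1.
Qed.
Let BC : B^* = B. Proof. by apply/conj_Creal/ger0_real. Qed.

Definition burau (i : 'I_3.-1) (b : bool) : 'M[algC]_2 :=
  if i == 0 :> nat then (if b then mx2 x 0 0 (- x^-1) else mx2 x^-1 0 0 (- x))
  else (if b then mx2 A B B D else mx2 (- D) B B (- A)).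

Lemma burauV i b : burau i b *m burau i (~~ b) = 1%:M.
Proof.
rewrite -mx2_1 /burau; case: i => -[|[|//]] hi; case: b;
  by rewrite /= mx2M ?BB; congr mx2; first [ring | field].
Qed.

Let q0 : x ^+ 2 + 1 != 0.
Proof.
rewrite (_ : x ^+ 2 + 1 = x * w); first exact: mulf_neq0.
by rewrite /w; field.
Qed.

Let trace_s2 : A + D = x - x^-1.
Proof. by rewrite /A /D /w; field; rewrite q0 x0. Qed.

Let trace_s1s2 : x * A - x^-1 * D = - 1.
Proof. by rewrite /A /D /w; field; rewrite q0 x0. Qed.

Lemma burau_artin :
  burau letter1 true *m (burau letter2 true *m burau letter1 true) =
  burau letter2 true *m (burau letter1 true *m burau letter2 true).
Proof.
rewrite /burau /= !mx2M !mul0r !mulr0 !addr0 !add0r.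
have AE : A = - (x * (x ^+ 2 + 1))^-1 by rewrite /A /w; field; rewrite q0 x0.
have DE : D = x ^+ 3 / (x ^+ 2 + 1) by rewrite /D /w; field; rewrite q0 x0.
have e1 : x * A * x = A * (x * A) - x^-1 * (1 + A * D).
  by rewrite AE DE; field; rewrite q0 x0.
have e2 := trace_s1s2.
have e4 : - x^-1 * (D * - x^-1) = x * (1 + A * D) - x^-1 * (D * D).
  by rewrite AE DE; field; rewrite q0 x0.
congr mx2.
- by rewrite mulrA e1 -BB; ring.
- by transitivity (B * (x * A - x^-1 * D)); [rewrite e2; field | ring].
- by transitivity (B * (x * A - x^-1 * D)); [rewrite e2; field | ring].
- by rewrite e4 -BB; ring.
Qed.

Definition burau_rep : braid 3 -> 'M[algC]_2 := braid_rep ( *%R : 'M[algC]_2 -> _) burau.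

Lemma burau_repM a b : burau_rep (a * b)%g = burau_rep a *m burau_rep b.
Proof. by apply: braid_repM; [exact: burauV | exact: burau_artin]. Qed.

Lemma burau_rep1 : burau_rep 1%g = 1%:M.
Proof. by apply: braid_rep1; [exact: burauV | exact: burau_artin]. Qed.

Lemma burau_rep_sigma i : burau_rep (sigma i) = burau i true.
Proof. by apply: braid_rep_sigma; [exact: burauV | exact: burau_artin]. Qed.

Lemma burau_rep_sigmaV i : burau_rep (sigma i)^-1%g = burau i false.
Proof. by apply: braid_rep_sigmaV; [exact: burauV | exact: burau_artin]. Qed.

Lemma burau_unitary i b : burau i b \is unitarymx.
Proof.
apply/unitarymxP; rewrite -(burauV i b); congr (_ *m _).
apply/matrixP => k l; rewrite /burau !mxE.
case: i k l => -[|[|//]] hi [[|[|//]] hk] [[|[|//]] hl]; case: b => //=;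
  by rewrite !mxE ?rmorphN /= ?fmorphV /= ?xC ?AC ?DC ?BC ?conjC0 ?opprK ?invrK.
Qed.

Lemma burau_rep_unitary b : burau_rep b \is unitarymx.
Proof.
elim/braid_ind: b => [|i b IHb|i b IHb].
- by rewrite burau_rep1; apply/unitarymxP; rewrite mul1mx trmx1 map_mx1.
- by rewrite burau_repM burau_rep_sigma mul_unitarymx ?burau_unitary.
- by rewrite burau_repM burau_rep_sigmaV mul_unitarymx ?burau_unitary.
Qed.

Lemma burau_quadratic i : burau i true = (x - x^-1)%:M + burau i false.
Proof.
apply/matrixP => k l; rewrite /burau !mxE.
case: i k l => -[|[|//]] hi [[|[|//]] hk] [[|[|//]] hl] //=;
  by rewrite !mxE /= ?mulr1n ?mulr0n; first [ring | rewrite -trace_s2; ring].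
Qed.

Lemma burau_hecke : hecke_trace (x - x^-1) (fun b => \tr (burau_rep b)).
Proof.
split=> [i a b|||].
- rewrite !burau_repM burau_rep_sigma burau_rep_sigmaV burau_quadratic.
  by rewrite mulmxDr mulmxDl mxtraceD mul_mx_scalar -scalemxAl mxtraceZ.
- by rewrite !burau_rep_sigma /burau /= !mx2_tr trace_s2.
- by rewrite !burau_repM mxtrace_mulC.
- by rewrite !burau_repM mxtrace_mulC mulmxA.
Qed.

(** The Burau trace is the trace of a unitary matrix of size two. *)
Lemma burau_trace_le2 b c : expands b c ->
  `|eval_z x (burau_trace c)| <= 2.
Proof.
move=> hc; apply: le_trans (unitary_trace_le (burau_rep_unitary b)).
rewrite (hc _ _ _ burau_hecke) burau_repM burau_rep1 !burau_rep_sigma /burau /=.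
rewrite mx2M !mx2_tr mxtrace1 /burau_trace !evalE.
have -> : x * A + 0 * B + (0 * B + - x^-1 * D) = - 1 by rewrite -trace_s1s2; ring.
rewrite le_eqVlt; apply/orP; left; apply/eqP; congr (`|_|); ring.
Qed.
End Unitary.

(** * Closures with equal Jones polynomials *)

Definition zsign (R : pzRingType) (e : int) : R := (-1) ^+ absz e.

Lemma exprN1z (K : fieldType) (e : int) : (-1 : K) ^ e = zsign K e.
Proof. by case: e => n; rewrite /zsign ?NegzE -?exprz_inv ?invrN1. Qed.

Lemma exprNz (K : fieldType) (x : K) e : (- x) ^ e = zsign K e * x ^ e.
Proof. by rewrite -mulN1r expfzMl exprN1z. Qed.

Lemma specializes_jones_expr (K : fieldType) (x : K) e a : x != 0 ->
  specializes x (jones_expr sqrt_t e a) (jones_expr x e a).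
Proof.
move=> x0; rewrite /jones_expr /twice_cos !exprNz /zsign -!exprVn.
by specializing; rewrite -[-1](@rmorphN1 int); exact: specializes_int.
Qed.

Definition same_jones e a f a' := forall (K : fieldType) (x : K), x != 0 ->
  jones_expr x e a = jones_expr x f a'.

Lemma same_jones_everywhere e a f a' :
  jones_expr sqrt_t e a = jones_expr sqrt_t f a' -> same_jones e a f a'.
Proof.
move=> h K x x0; apply: (specializes_eq x0 (specializes_jones_expr e a x0)).
rewrite h; exact: specializes_jones_expr.
Qed.

(** The property of Burau traces that excludes most pairs of exponent sums. *)
Definition trace_bounded (a : {poly int}) := forall x : algC, `|x| = 1 -> 1 <= `|x + x^-1| ->
  `|eval_z x a| <= 2.

Lemma intpoly_eval_at0 (R : comNzRingType) f : intpoly_eval (0 : R) f = (f`_0)%:~R.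
Proof. by rewrite /intpoly_eval horner_coef0 coef_map. Qed.

Lemma zsign_intrK (K : fieldType) e : zsign K e = (zsign int e)%:~R.
Proof. by rewrite /zsign rmorphXn rmorphN1. Qed.

Lemma zsignP (e : int) : zsign int e = 1 \/ zsign int e = -1.
Proof. by rewrite /zsign -signr_odd; case: (odd _); [right; rewrite expr1|left]. Qed.

(** At [x = 1] the Hecke algebra becomes the group algebra of the symmetric group, and the
    trace would have to be [0] for odd and [2] or [-1] for even permutations; a congruence
    modulo three and the bound are enough to separate the parities. *)
Lemma burau_trace_at1 b c : expands b c -> exists a u : int,
  [/\ eval_z (1 : algC) (burau_trace c) = a%:~R, - 2 <= a <= 2 &
      (zsign int (exponent b) = 1 /\ a = 3 * u - 1) \/
      (zsign int (exponent b) = -1 /\ a = 3 * u)].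
Proof.
move=> hc; have n1 : (1 : algC) != 0 by exact: oner_neq0.
have := expands_power n1 hc; have := expands_powerV n1 hc.
have /= := @burau_trace_le2 (1 : algC) (normr1 _) _ _ _ hc.
rewrite invr1 subrr /burau_trace !evalE !intpoly_eval_at0 exprN1z zsign_intrK exp1rz.
rewrite !mul0r !mul1r !addr0 expr1n invr1 !mul1r.
set u := c.1.1`_0; set v := c.1.2`_0; set w := c.2`_0.
move=> hb e1 e2; exists (u + u - w), u.
have {}hb : - 2 <= u + u - w <= 2.
  rewrite -ler_norml -(ler_int algC) intr_norm rmorphB rmorphD; apply: hb.
  by rewrite ger0_norm ?ler_wpDl ?addr_ge0.
have {}e1 : zsign int (exponent b) = u - v + w.
  by apply: (@intr_inj algC); rewrite e1 rmorphD rmorphB.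
have {}e2 : 1 = u + v + w by apply: (@intr_inj algC); rewrite !rmorphD.
rewrite rmorphB rmorphD; split=> //.
by case: (zsignP (exponent b)) e1 => -> e1; [left|right]; split=> //; lia.
Qed.

Lemma same_jones_parity b c b' c' : expands b c -> expands b' c' ->
  same_jones (exponent b) (burau_trace c) (exponent b') (burau_trace c') ->
  zsign int (exponent b) = zsign int (exponent b').
Proof.
move=> /burau_trace_at1 [a [u [ea ha su]]] /burau_trace_at1 [a' [u' [ea' ha' su']]].
move=> /(_ algC 1 (oner_neq0 _)); rewrite /jones_expr /twice_cos ea ea'.
rewrite !exprNz !exp1rz expr1n invr1 !mulr1 !mul1r !zsign_intrK.
rewrite -[1 + 1]/(2%:~R) -!intrM -!intrD => /intr_inj.
by case: su su' => -[-> ?] [] [-> ?]; lia.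
Qed.

Lemma zsign_eq (e f : int) : zsign int e = zsign int f -> exists m : int, f = e + (m + m).
Proof.
rewrite /zsign -signr_odd -[in RHS]signr_odd => h.
exists ((f - e) %/ 2)%Z.
have : odd `|e| = odd `|f| by move: h; case: (odd _); case: (odd _).
lia.
Qed.

(** Here [p = x ^ e], [y = x ^ m] and [s = (-1) ^ e]; the two equations assumed are the equality
    of the Jones polynomials at [x] and at [- x^-1]. *)
Lemma solve_two_relations (K : fieldType) (x y p s Q a b : K) : y != 0 -> p != 0 ->
  s * p * Q + p ^+ 2 * a = s * (p * y ^+ 2) * Q + (p * y ^+ 2) ^+ 2 * b ->
  p^-1 * Q + p ^- 2 * a = (p * y ^+ 2)^-1 * Q + (p * y ^+ 2) ^- 2 * b ->
  (y ^+ 4 - y ^- 4) * a = - Q * (y - y^-1) * (p * y ^+ 3 + s * (p * y ^+ 3)^-1) /\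
  (y ^+ 4 - y ^- 4) * b = - Q * (y - y^-1) * (p * y^-1 + s * (p * y^-1)^-1).
Proof.
move=> y0 p0 e1 e2.
have {}e1 : s / p * Q + a = s * y ^+ 2 * Q / p + y ^+ 4 * b.
  apply: (mulfI (expf_neq0 2 p0)).
  rewrite (_ : _ * (s / p * Q + a) = s * p * Q + p ^+ 2 * a); last by field.
  by rewrite e1; field.
have {}e2 : p * Q + a = p * Q / y ^+ 2 + b / y ^+ 4.
  apply: (mulfI (invr_neq0 (expf_neq0 2 p0))).
  rewrite (_ : _ * (p * Q + a) = p^-1 * Q + p ^- 2 * a); last by field.
  by rewrite e2; field; rewrite y0 p0.
split.
  transitivity (y ^+ 4 * (p * Q + a) - y ^- 4 * (s / p * Q + a)
                - y ^+ 4 * p * Q + y ^- 4 * s / p * Q).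
    by field; rewrite p0 y0.
  by rewrite e1 e2; field; rewrite p0 y0.
have -> : (y ^+ 4 - y ^- 4) * b =
    (s / p * Q + a) - (p * Q + a) - s * y ^+ 2 * Q / p + p * Q / y ^+ 2.
  by rewrite e1 e2; field; rewrite p0 y0.
by field; rewrite p0 y0.
Qed.

(** The Burau trace [a] solved from the equality of two Jones polynomials whose exponent
    sums differ by [2 m]. *)
Definition isolated_at (K : fieldType) (x : K) m (sgn : int) a nu :=
  (x ^ (4 * m) - x ^ (- (4 * m))) * eval_z x a =
  - twice_cos x * (x ^ m - x ^ (- m)) * (x ^ nu + sgn%:~R * x ^ (- nu)).

Definition isolated m (sgn : int) (a : {poly int}) (nu : int) :=
  forall (K : fieldType) (x : K), x != 0 -> isolated_at x m sgn a nu.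

Lemma zsignDD (R : pzRingType) e m : zsign R (e + (m + m)) = zsign R e.
Proof.
rewrite /zsign -signr_odd -[RHS]signr_odd; congr (_ ^+ nat_of_bool _); lia.
Qed.

Lemma zsign_double (R : pzRingType) e : zsign R (e + e) = 1.
Proof. by rewrite -[e + e]add0r zsignDD. Qed.

(** The Burau traces depend on [z] only, so they are unchanged when [x] is replaced by [-
    x^-1]. This gives a second equation, and the two equations determine both traces from
    [e] and [m]. *)
Lemma same_jones_isolated e m a b : same_jones e a (e + (m + m)) b ->
  isolated m (zsign int e) a (e + 3 * m) /\ isolated m (zsign int e) b (e - m).
Proof.
move=> h; suff H (K : fieldType) (x : K) : x != 0 ->
    isolated_at x m (zsign int e) a (e + 3 * m) /\ isolated_at x m (zsign int e) b (e - m).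
  by split=> K x x0; [exact: (H K x x0).1 | exact: (H K x x0).2].
move=> x0; have E1 := h K x x0.
have x0' : - x^-1 != 0 by rewrite oppr_eq0 invr_eq0.
have E2 := h K (- x^-1) x0'; move: E1 E2.
have y0 : x ^ m != 0 by rewrite expfz_neq0.
have p0 : x ^ e != 0 by rewrite expfz_neq0.
have exp2 k : x ^ (k + k) = (x ^ k) ^+ 2 by rewrite expfzDr.
have exp4 k : x ^ (4 * k) = (x ^ k) ^+ 4.
  by rewrite (_ : 4 * k = (k + k) + (k + k)) ?expfzDr //; ring.
have exp3 k : x ^ (3 * k) = (x ^ k) ^+ 3.
  by rewrite (_ : 3 * k = (k + k) + k) ?expfzDr //; ring.
rewrite /isolated_at /jones_expr opprK !invrN !invrK !exprNz !zsignDD !zsign_double !mul1r.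
rewrite zsign_intrK -!invr_expz !exprz_inv -!invr_expz.
rewrite (_ : - x^-1 - - x = x - x^-1); last by rewrite opprK addrC.
rewrite (_ : twice_cos (- x^-1) = twice_cos x); last first.
  by rewrite /twice_cos sqrrN exprVn invrK addrC.
rewrite !exp2 !expfzDr // exp4 exp3 -invr_expz -!expr2 => E1 E2.
exact: solve_two_relations y0 p0 E1 E2.
Qed.

Lemma expz_sub_neq0 (K : fieldType) (x : K) (m : nat) : x != 0 -> x ^+ (m + m) != 1 ->
  x ^ m%:Z - x ^ (- m%:Z) != 0.
Proof.
move=> x0; apply: contra_neq => /eqP; rewrite subr_eq0 => /eqP h.
by rewrite exprD -exprnP in h *; rewrite {1}h -exprnN mulVf ?expf_neq0.
Qed.

(** The factor of the Burau trace does not vanish at the generic point. *)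
Lemma isolated_unique (m : nat) sgn a a' nu : (0 < m)%N ->
  isolated m sgn a nu -> isolated m sgn a' nu -> eval_z sqrt_t a = eval_z sqrt_t a'.
Proof.
move=> m0 /(_ _ _ sqrt_t_neq0) h /(_ _ _ sqrt_t_neq0) h'.
have n0 : sqrt_t ^ (4 * m%:Z) - sqrt_t ^ (- (4 * m%:Z)) != 0.
  rewrite -PoszM; apply: expz_sub_neq0 sqrt_t_neq0 _.
  by apply: sqrt_t_expr_neq1; rewrite addn_gt0 muln_gt0 m0.
by apply: (mulfI n0); rewrite h h'.
Qed.

(** * Values of the Burau trace at roots of unity *)

(** At a root of unity where the left-hand side of [isolated_at] vanishes, one of the
    factors of the right-hand side must vanish as well. *)
Lemma isolated_root (m : nat) sgn a nu (x : algC) : (0 < m)%N -> isolated m sgn a nu ->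
  x ^+ (8 * m) = 1 -> x ^+ (2 * m) != 1 -> x ^+ 4 != -1 -> x ^ (nu + nu) = - sgn%:~R.
Proof.
move=> m0 h x8 x2 x4; have x0 : x != 0.
  by apply/eqP => xz; move/eqP: x8; rewrite xz expr0n muln_eq0 /= eqn0Ngt m0 eq_sym oner_eq0.
have := h _ _ x0; rewrite /isolated_at.
have -> : x ^ (4 * m%:Z) = x ^ (- (4 * m%:Z)).
  rewrite -PoszM -exprnN -exprnP; apply: (mulIf (expf_neq0 (4 * m) x0)).
  by rewrite mulVf ?expf_neq0 // -exprD -mulnDl.
rewrite subrr mul0r => /esym/eqP; rewrite !mulf_eq0 oppr_eq0 -!orbA => /or3P[q|y|].
- move: x4; rewrite -subr_eq0 opprK (_ : x ^+ 4 + 1 = x ^+ 2 * twice_cos x).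
    by rewrite (eqP q) mulr0 eqxx.
  by rewrite /twice_cos; field.
- by move: y; rewrite (negPf (expz_sub_neq0 _ _)) // addnn -mul2n.
- rewrite expfzDr // addr_eq0 => /eqP h1; rewrite {1}h1 -mulNr -mulrA -invr_expz mulVf ?mulr1 //.
  exact: expfz_neq0.
Qed.

Lemma geometric_quotient (K : fieldType) (u al r : K) (n : nat) : u != 1 ->
  (1 - u) * al = r * (1 - u ^+ n) -> al = r * (\sum_(i < n) u ^+ i).
Proof.
move=> u1 e; have u1' : 1 - u != 0 by rewrite subr_eq0 eq_sym.
by apply: (mulfI u1'); rewrite e -[1 - u ^+ n]opprB subrX1; ring.
Qed.

Lemma geometric_neg (K : fieldType) (u r : K) (n : nat) : u != 0 ->
  r * (1 - u ^ Negz n) = - r * u ^ Negz n * (1 - u ^+ n.+1).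
Proof. by move=> u0; rewrite NegzE -exprnN; field; rewrite expf_neq0. Qed.

(** The quotient of [1 - u ^ l] by [1 - u] is a Laurent polynomial in [u] with value [l] at
    [u = 1], for every integer [l]. *)
Lemma geometric_specialization (K : fieldType) (x : K) (u al r : ratfrac) (al' r' : K)
    (l : int) : x != 0 ->
  specializes x u 1 -> specializes x u^-1 1 -> specializes x al al' ->
  specializes x r r' -> u != 1 -> u != 0 ->
  (1 - u) * al = r * (1 - u ^ l) -> al' = r' * l%:~R.
Proof.
move=> x0 hu huV ha hr u1 u0.
have nonneg (n : nat) rho rho' : specializes x rho rho' -> (1 - u) * al = rho * (1 - u ^+ n) ->
    al' = rho' * n%:R.
  move=> hrho /(geometric_quotient u1) ale.
  apply: (specializes_eq x0 ha); rewrite ale; apply: specializesM => //.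
  rewrite -[n in n%:R]card_ord -sum1_card natr_sum.
  apply: (@specializes_sum _ _ n (fun i => u ^+ i) (fun i => 1)) => i.
  by rewrite -[1](expr1n _ i); apply: specializesXn.
case: l => n; first exact: (nonneg n).
rewrite (geometric_neg r n u0) (_ : (Negz n)%:~R = - n.+1%:R :> K) // mulrN -mulNr.
apply: (nonneg n.+1 (- r * u ^ Negz n)).
have := specializesM (specializesN hr) (specializesXn n.+1 huV).
by rewrite expr1n mulr1 NegzE -exprz_inv.
Qed.

Lemma norm_root1 (x : algC) n : (0 < n)%N -> `|x ^+ n| = 1 -> `|x| = 1.
Proof. by move=> n0 /eqP; rewrite normrX pexprn_eq1 // eqn0Ngt n0 => /eqP. Qed.

Lemma conj_unit (x : algC) : `|x| = 1 -> x^* = x^-1.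
Proof. by move=> h; rewrite invC_norm h expr1n invr1 mul1r. Qed.

(** The [m]-th roots of unity sum up to [0] and one of them is [1], so their real parts
    cannot all be nonnegative. *)
Lemma root_negative_re (m : nat) : (1 < m)%N ->
  exists u : algC, u ^+ m = 1 /\ u + u^* < 0.
Proof.
move=> m1; have [w hw] := C_prim_root_exists (ltnW m1).
have [/existsP[i hi]|/existsPn h] := boolP [exists i : 'I_m, w ^+ i + (w ^+ i)^* < 0].
  by exists (w ^+ i); split=> //; rewrite exprAC (prim_expr_order hw) expr1n.
have S0 : \sum_(i < m) w ^+ i = 0.
  have w1 : w - 1 != 0.
    rewrite subr_eq0; apply: contraTneq m1 => w1.
    by have := prim_order_dvd hw 1; rewrite w1 expr1n eqxx dvdn1 => /eqP ->.
  by apply: (mulfI w1); rewrite -subrX1 (prim_expr_order hw) subrr mulr0.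
have : \sum_(i < m) (w ^+ i + (w ^+ i)^*) = 0.
  by rewrite big_split /= -rmorph_sum S0 raddf0 addr0.
have ge0 (i : 'I_m) : 0 <= w ^+ i + (w ^+ i)^*.
  have := h i; rewrite -real_leNgt //.
  by apply/CrealP; rewrite rmorphD /= conjCK addrC.
move/eqP; rewrite psumr_eq0 => [|i _]; last exact: ge0.
move/allP/(_ (Ordinal (ltnW m1)) (mem_index_enum _)).
by rewrite expr0 conjC1 -[1 + 1]/(2%:R) pnatr_eq0.
Qed.

Lemma twice_cos_real (x : algC) : `|x| = 1 -> twice_cos x \is Num.real.
Proof.
move=> x1; apply/CrealP; rewrite /twice_cos rmorphD /= fmorphV /= !rmorphXn /= conj_unit //.
by rewrite exprVn invrK addrC.
Qed.

(** The point is a fourth root of [y]. Multiplication by [i] changes the sign of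
    [twice_cos], which can therefore be taken nonnegative; the third property follows, as
    the square of [x + x^-1] is [twice_cos x + 2]. *)
Lemma unit_point_exists (m : nat) (y : algC) : (0 < m)%N -> y ^+ m = -1 ->
  exists x : algC, [/\ `|x| = 1, x ^+ (4 * m) = -1, 1 <= `|x + x^-1| &
    twice_cos x ^+ 2 = 2 + (y + y^*)].
Proof.
move=> m0 ym; have y1 : `|y| = 1 by apply: (norm_root1 m0); rewrite ym normrN1.
suff [x [x1 x4 xc]] : exists x : algC, [/\ `|x| = 1, x ^+ 4 = y & 0 <= twice_cos x].
  have x0 : x != 0 by rewrite -normr_eq0 x1 oner_eq0.
  exists x; split=> //.
  - by rewrite exprM x4.
  - have : 1 <= `|x + x^-1| ^+ 2.
      rewrite -normrX (_ : _ ^+ 2 = twice_cos x + 2); last by rewrite /twice_cos; field.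
      rewrite ger0_norm; last exact: addr_ge0.
      by apply: ler_wpDl => //; rewrite ler1n.
    by rewrite expr_ge1.
  - rewrite /twice_cos -x4 conj_unit ?normrX ?x1 ?expr1n //.
    by field.
have r1 : `|4.-root y| = 1 by apply: (@norm_root1 _ 4) => //; rewrite rootCK.
have [h|h] := real_ge0P (twice_cos_real r1); first by exists (4.-root y); rewrite rootCK.
exists ('i * 4.-root y); split.
- by rewrite normrM normCi mul1r.
- rewrite exprMn rootCK // (_ : 4 = 2 * 2)%N // exprM sqrCi sqrrN expr1n mul1r //.
- rewrite /twice_cos exprMn sqrCi mulN1r invrN -opprD oppr_ge0; exact: ltW.
Qed.

(** The ratio of [eval_z x a] to the quotient of [1 - u ^ l] by [1 - u], with [u = x ^ (- 8
    m)], when [isolated_at] holds with negative sign and exponent [4 m l]. *)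
Definition ratio_odd (K : fieldType) (x : K) (m l : int) :=
  - twice_cos x * (x ^ m - x ^ (- m)) * x ^ (4 * m * l) * x ^ (- (4 * m)).

Lemma isolated_geometric_odd (K : fieldType) (x : K) (m l : int) a : x != 0 ->
  isolated_at x m (-1) a (4 * m * l) ->
  (1 - x ^ (- (8 * m))) * eval_z x a = ratio_odd x m l * (1 - (x ^ (- (8 * m))) ^ l).
Proof.
move=> x0 h.
have -> : (x ^ (- (8 * m))) ^ l = x ^ (- (4 * m * l)) * x ^ (- (4 * m * l)).
  by rewrite -expfzDr // exprz_exp; congr (_ ^ _); ring.
have -> : x ^ (- (8 * m)) = x ^ (- (4 * m)) * x ^ (- (4 * m)).
  by rewrite -expfzDr //; congr (_ ^ _); ring.
have E k : x ^ k * x ^ (- k) = 1 by rewrite -expfzDr // addrN.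
transitivity (x ^ (- (4 * m)) * ((x ^ (4 * m) - x ^ (- (4 * m))) * eval_z x a)).
  by rewrite -[1](E (4 * m)); ring.
rewrite h /ratio_odd mulrN1z mulN1r.
transitivity (- twice_cos x * (x ^ m - x ^ (- m)) * x ^ (- (4 * m)) *
   (x ^ (4 * m * l) - x ^ (4 * m * l) * x ^ (- (4 * m * l)) * x ^ (- (4 * m * l)))).
  by rewrite E; ring.
by ring.
Qed.

Lemma specializes_ratio_odd (K : fieldType) (x : K) m l : x != 0 ->
  specializes x (ratio_odd sqrt_t m l) (ratio_odd x m l).
Proof.
by move=> x0; rewrite /ratio_odd /twice_cos -!exprVn; specializing.
Qed.

Lemma specializes_trace (K : fieldType) (x : K) a : x != 0 ->
  specializes x (eval_z sqrt_t a) (eval_z x a).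
Proof. by move=> x0; specializing. Qed.

Lemma norm_expz (x : algC) (k : int) : `|x| = 1 -> `|x ^ k| = 1.
Proof.
by move=> h; case: k => n; rewrite ?NegzE -?exprz_inv normrX ?normfV h ?invr1 expr1n.
Qed.

Lemma sqrt_t_expz_neq1 (n : nat) : (0 < n)%N -> sqrt_t ^ (- n%:Z) != 1.
Proof. by move=> n0; rewrite -exprnN invr_eq1 sqrt_t_expr_neq1. Qed.

(** At a point where [x ^ (4 m) = -1] the Burau trace has absolute value [|l|] times [sqrt
    2] times [|twice_cos x|]. A suitable point makes the last factor larger than [sqrt 2],
    and then the trace exceeds [2] unless [l = 0]. *)
Lemma exponent_odd_eq0 (m : nat) a (l : int) : odd m -> (2 < m)%N ->
  isolated m (-1) a (4 * m%:Z * l) -> trace_bounded a -> l = 0.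
Proof.
move=> om m2 h ba; have m0 : (0 < m)%N by lia.
have [u [um un]] := root_negative_re (ltnW m2).
have [|x [x1 x4m xw xQ]] := @unit_point_exists m (- u) m0.
  by rewrite exprNn -signr_odd om expr1 um mulr1.
have x0 : x != 0 by rewrite -normr_eq0 x1 oner_eq0.
have x8m : x ^+ (8 * m) = 1.
  rewrite (_ : 8 * m = 4 * m + 4 * m)%N; last by lia.
  by rewrite exprD x4m mulrNN mulr1.
have := geometric_specialization (l := l) x0 _ _ (specializes_trace a x0)
  (specializes_ratio_odd m l x0) _ _ (isolated_geometric_odd sqrt_t_neq0 (h _ _ sqrt_t_neq0)).
rewrite -(PoszM 8) => S.
have {S} S : eval_z x a = ratio_odd x m l * l%:~R.
  apply: S.
  - by rewrite -[X in specializes _ _ X]invr1 -x8m exprnN; exact: specializesXz.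
  - rewrite invr_expz opprK -x8m; exact: specializesXz.
  - by rewrite sqrt_t_expz_neq1 // muln_gt0.
  - by rewrite expfz_neq0 // sqrt_t_neq0.
have Q2 : 2 < twice_cos x ^+ 2.
  by rewrite xQ rmorphN /= -opprD ltrDl oppr_gt0.
(* [x ^ (2 m)] is a square root of [-1], whence the factor [2]. *)
have n2 : `|ratio_odd x m l| ^+ 2 = twice_cos x ^+ 2 * 2.
  rewrite /ratio_odd !normrM !norm_expz // normrN !mulr1 exprMn.
  congr (_ * _); first by rewrite real_normK // twice_cos_real.
  rewrite -normrX -exprnN -exprnP.
  have -> : (x ^+ m - x ^- m) ^+ 2 = x ^- (m + m) * (x ^+ (4 * m) + 1) - 2.
    rewrite (_ : 4 * m = m + m + m + m)%N ?exprD; last by lia.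
    by field; rewrite expf_neq0.
  by rewrite x4m addNr mulr0 sub0r normrN normr_nat.
have hb : twice_cos x ^+ 2 * 2 * `|l%:~R : algC| ^+ 2 <= 2 ^+ 2.
  rewrite -n2 -exprMn -normrM -S; apply: lerXn2r; rewrite ?nnegrE //.
  exact: ba.
have Q0 : 0 <= twice_cos x ^+ 2 by apply: le_trans (ltW Q2).
apply/eqP; apply: contraTT hb => l0; rewrite -real_ltNge; last 2 first.
- by apply: ger0_real; rewrite exprn_ge0.
- by apply: ger0_real; rewrite mulr_ge0 // mulr_ge0.
have l1 : 1 <= `|l%:~R : algC| ^+ 2.
  by rewrite expr_ge1 // -intr_norm ler1z; lia.
rewrite (_ : 2 ^+ 2 = 2 * 2); last by rewrite expr2.
apply: (@lt_le_trans _ _ (twice_cos x ^+ 2 * 2)).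
  by rewrite ltr_pM2r.
by rewrite ler_peMr // mulr_ge0.
Qed.

(** For [m = 2] the factors of the right-hand side of [isolated_at] combine into [x ^ 4 - x
    ^ -4], which cancels. *)
Lemma isolated_geometric_two (K : fieldType) (x : K) (p : int) a : x != 0 -> x ^+ 8 != 1 ->
  zsign int p = -1 -> isolated_at x 2 1 a (4 * p) ->
  (1 - (- x ^- 8)) * eval_z x a = - x ^ (4 * p - 4) * (1 - (- x ^- 8) ^ p).
Proof.
move=> x0 x8 sp; rewrite /isolated_at mul1r => h.
have {}h : (x ^+ 4 + x ^- 4) * eval_z x a = - (x ^ (4 * p) + x ^ (- (4 * p))).
  have n0 : x ^+ 4 - x ^- 4 != 0 by rewrite exprnN (@expz_sub_neq0 _ x 4).
  apply: (mulfI n0); transitivity ((x ^ (4 * 2) - x ^ (- (4 * 2))) * eval_z x a).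
    by rewrite -!exprnN -!exprnP; field.
  rewrite h /twice_cos -!exprnN -!exprnP.
  by move: (x ^ (4 * p)) (x ^ (- (4 * p))) => y y'; field.
have -> : (- x ^- 8) ^ p = - (x ^ (- (4 * p)) * x ^ (- (4 * p))).
  rewrite exprNz zsign_intrK sp mulrN1z mulN1r exprnN exprz_exp -expfzDr //.
  by congr (- (_ ^ _)); ring.
transitivity (x ^- 4 * ((x ^+ 4 + x ^- 4) * eval_z x a)); first by field.
rewrite h expfzDr // -exprnN.
have E : x ^ (4 * p) * x ^ (- (4 * p)) = 1 by rewrite -expfzDr // addrN.
transitivity (- x ^- 4 * (x ^ (4 * p) + x ^ (4 * p) * x ^ (- (4 * p)) * x ^ (- (4 * p)))).
  by rewrite E; ring.
by ring.
Qed.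

Lemma sqrt_t_expr_neqN1 n : (0 < n)%N -> sqrt_t ^+ n != -1.
Proof.
move=> n0; apply: contra_neq (@sqrt_t_expr_neq1 (n * 2) _) => [h|].
  by rewrite exprM h sqrrN expr1n.
by rewrite muln_gt0 n0.
Qed.

Lemma opp_exprV_neq0 (K : fieldType) (x : K) n : x != 0 -> - x ^- n != 0.
Proof. by move=> x0; rewrite oppr_eq0 invr_eq0 expf_neq0. Qed.

Lemma opp_exprV_neq1 (K : fieldType) (x : K) n : x ^+ n != -1 -> - x ^- n != 1.
Proof. by rewrite eqr_oppLR -[X in _ -> _ != X]invrN1 (inj_eq invr_inj). Qed.

(** At a suitable primitive 16-th root of unity the Burau trace has absolute value [|p|]. *)
Lemma exponent_two_le2 a (p : int) : zsign int p = -1 -> isolated 2 1 a (4 * p) ->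
  trace_bounded a -> - 2 <= p <= 2.
Proof.
move=> sp h ba.
have [|x [x1 x8 xw _]] := @unit_point_exists 2 'i isT; first exact: sqrCi.
have x0 : x != 0 by rewrite -normr_eq0 x1 oner_eq0.
have X0 := sqrt_t_neq0; have X8 := @sqrt_t_expr_neq1 8 isT.
have S := geometric_specialization (l := p) x0 _ _ (specializes_trace a x0) _ _ _
   (isolated_geometric_two X0 X8 sp (h _ _ X0)).
have {S} S : eval_z x a = - x ^ (4 * p - 4) * p%:~R.
  apply: S.
  - by rewrite -[1]opprK -x8 -[x ^+ 8]invrK x8 invrN1 -x8 -!exprVn; specializing.
  - by rewrite invrN invrK -[1]opprK -x8; specializing.
  - by specializing.
  - exact/opp_exprV_neq1/sqrt_t_expr_neqN1.
  - exact: (opp_exprV_neq0 8 X0).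
have := ba x x1 xw; rewrite S normrM normrN norm_expz // mul1r -intr_norm.
by rewrite -[2]/(2%:~R) ler_int ler_norml.
Qed.

Lemma prim_root_expz n (w : algC) (k : int) : n.-primitive_root w -> w ^ k = 1 -> (n %| k)%Z.
Proof.
move=> hw; rewrite dvdzE /= (prim_order_dvd hw).
case: k => k; rewrite ?NegzE ?absrzN -?exprnN /=; first by move/eqP.
by move/eqP; rewrite invr_eq1.
Qed.

Lemma zsign_odd (e : int) : zsign int e = -1 -> odd `|e|.
Proof. by rewrite /zsign -signr_odd; case: (odd _). Qed.

(** By [isolated_root] at a primitive root of unity of order [8 m], and at its square if [m
    > 2], the exponent [e + 3 m] is a multiple of [4 m] if [m > 2], and an odd multiple of
    [4] if [m = 2]. The bounds then apply to both traces, whose exponents differ by [4 m]: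
    for [m > 2] the two multiples, being consecutive, cannot both be [0]; for [m = 2] the
    two odd numbers differ by [2] and have absolute value at most [2], so they are [1] and
    [-1]. *)
Lemma exponent_gap e a b (m : nat) : (0 < m)%N -> same_jones e a (e + (m%:Z + m%:Z)) b ->
  trace_bounded a -> trace_bounded b -> m = 1 \/ m = 2 /\ e = -2.
Proof.
move=> m0 /same_jones_isolated [D1 D2] ba bb.
have [?|m2] := leqP m 1; first by left; lia.
right; have n0 : (0 < 8 * m)%N by rewrite muln_gt0.
have [w hw] := C_prim_root_exists n0.
have w_neq1 i : (0 < i)%N -> (i < 8 * m)%N -> w ^+ i != 1.
  by move=> i0 i8; rewrite -(prim_order_dvd hw) gtnNdvd.
have w_neqN1 i : (0 < i)%N -> (2 * i < 8 * m)%N -> w ^+ i != -1.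
  move=> i0 i8; apply: contraTneq (w_neq1 (2 * i)%N _ i8) => [wi|].
    by rewrite mulnC exprM wi sqrrN expr1n eqxx.
  by rewrite muln_gt0.
have Dw := isolated_root m0 D1 (prim_expr_order hw) (w_neq1 _ _ _) (w_neqN1 4%N isT _).
have {}Dw : w ^ (e + 3 * m%:Z + (e + 3 * m%:Z)) = - (zsign int e)%:~R by apply: Dw; lia.
have w0 : w != 0.
  apply: contra_eq_neq (prim_expr_order hw) => ->.
  by rewrite expr0n eqn0Ngt n0 eq_sym oner_eq0.
have [m3|m3] := leqP m 2.
  have m2' : m = 2%N by lia.
  subst m; split=> //; set nu := e + 3 * 2%:Z in D1 Dw.
  have wD k l : w ^ (k + l) = w ^ k * w ^ l by rewrite expfzDr.
  have [se|se] := zsignP e; rewrite se in D1 D2 Dw.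
    have w4 : w ^ (nu + nu + (nu + nu)) = 1 by rewrite wD Dw mulrNN mulr1.
    have /dvdzP[p np] := prim_root_expz hw w4.
    have {}np : nu = 4 * p by lia.
    have w8 : w ^+ 8 = -1.
      have /eqP : w ^+ 8 ^+ 2 = 1 by rewrite -exprM (prim_expr_order hw).
      by rewrite sqrf_eq1 (negPf (w_neq1 8 _ _)) //= => /eqP.
    have sp : zsign int p = -1.
      move: Dw; rewrite np (_ : 4 * p + 4 * p = 8%:Z * p); last by ring.
      rewrite -exprz_exp -exprnP w8 exprN1z zsign_intrK => h.
      by apply: (@intr_inj algC); rewrite h.
    rewrite np in D1.
    rewrite (_ : e - 2%:Z = 4 * (p - 2)) in D2; last by rewrite /nu in np; lia.
    have sp2 : zsign int (p - 2) = -1 by rewrite -sp (zsignDD _ p (-1)).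
    have := exponent_two_le2 sp D1 ba; have := exponent_two_le2 sp2 D2 bb.
    by have := zsign_odd sp; rewrite /nu in np; lia.
  have /dvdzP[p np] : (16 %| nu + nu)%Z by apply: (prim_root_expz hw); rewrite Dw opprK.
  by have := zsign_odd se; rewrite /nu in np; lia.
exfalso; set nu := e + 3 * m%:Z in D1 Dw.
have D2w : (w ^+ 2) ^ (nu + nu) = - (zsign int e)%:~R.
  apply: (isolated_root m0 D1).
  - by rewrite exprAC (prim_expr_order hw) expr1n.
  - by rewrite -exprM; apply: w_neq1; lia.
  - by rewrite -exprM; apply: w_neqN1; lia.
(* The square of the value [- s] at [w] is the value at the square of [w], again [- s]. *)
have se : zsign int e = -1.
  case: (zsignP e) => // se; move: D2w.
  rewrite expr2 expfzMl Dw se mulrNN mulr1 => /eqP.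
  by rewrite -subr_eq0 opprK -[1 + _]/(2%:R) pnatr_eq0.
rewrite se in D1 D2 Dw; have {}Dw : w ^ (nu + nu) = 1 by rewrite Dw opprK.
have /dvdzP[p np] := prim_root_expz hw Dw.
have {}np : nu = 4 * m%:Z * p by lia.
have om : odd m by have := zsign_odd se; rewrite /nu in np; lia.
rewrite np in D1; have p0 := exponent_odd_eq0 om m3 D1 ba.
rewrite (_ : e - m%:Z = 4 * m%:Z * (p - 1)) in D2; last by rewrite /nu in np; lia.
have := exponent_odd_eq0 om m3 D2 bb; lia.
Qed.

(** * Comparison with torus links *)

(** Two braids with equal Jones polynomials and exponent sums [e] and [e + 2 m], [m > 0],
    have Burau traces that depend on [e] and [m] only. So if one such pair of braids has
    equal Homflypt polynomials, all of them do. *)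
Lemma homflypt_same_pair P (hP : is_homflypt P) (m : nat) b b' b0 b0' : (0 < m)%N ->
  exponent b' = exponent b + (m%:Z + m%:Z) -> exponent b0 = exponent b ->
  exponent b0' = exponent b' -> jones P (closure b) = jones P (closure b') ->
  P (closure b0) = P (closure b0') -> P (closure b) = P (closure b').
Proof.
move=> m0 ee e0 e0' J PP0; have J0 : jones P (closure b0) = jones P (closure b0').
  by rewrite /jones PP0.
have [c hc] := expandable_braid b; have [c' hc'] := expandable_braid b'.
have [d hd] := expandable_braid b0; have [d' hd'] := expandable_braid b0'.
rewrite (jones_formula hP hc) (jones_formula hP hc') ee in J.
rewrite (jones_formula hP hd) (jones_formula hP hd') e0 e0' ee in J0.
have [D1 D2] := same_jones_isolated (same_jones_everywhere J).
have [D1' D2'] := same_jones_isolated (same_jones_everywhere J0).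
transitivity (P (closure b0)).
  by apply: (homflypt_determined hP hc hd) => //; apply: isolated_unique m0 D1 D1'.
rewrite PP0; apply: (homflypt_determined hP hd' hc') => //.
exact: isolated_unique m0 D2' D2.
Qed.

Definition power_word (k : int) : seq bool := nseq (absz k) (0 <= k)%R.

Lemma exponent_power_word k b : exponent (braid_of (word1 (power_word k) ++ [:: (letter2, b)])) =
  k + (if b then 1 else - 1).
Proof.
rewrite braid_of_cat exponentM; congr (_ + _); last first.
  by case: b; rewrite -?sigmaV ?exponentE // -[braid_of _]/(sigma _) exponentE.
rewrite /power_word; have [k0|k0] := lerP 0 k.
  rewrite -[in RHS](gez0_abs k0); elim: (absz k) => [|n IHn]; first by rewrite exponent1.
  by rewrite /= braid_of_cons /= !exponentE IHn; lia.
rewrite -[in RHS](opprK k) -[in RHS](ltz0_abs k0).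
elim: (absz k) => [|n IHn]; first by rewrite exponent1.
by rewrite /= braid_of_cons /= !exponentE IHn; lia.
Qed.

(** Both closures are the torus link of type [(2, k)]. *)
Lemma homflypt_power_word (P : oriented_link -> laurent) k :
  P (closure (braid_of (word1 (power_word k) ++ [:: (letter2, false)]))) =
  P (closure (braid_of (word1 (power_word k) ++ [:: (letter2, true)]))).
Proof. by rewrite (@closure_markov _ false [::] (power_word k) true [::]). Qed.

Lemma burau_trace_bounded b c : expands b c -> trace_bounded (burau_trace c).
Proof. by move=> hc x x1 x2; apply: burau_trace_le2 hc. Qed.

Theorem proposition2p18 (P : oriented_link -> laurent) (hP : is_homflypt P)
    (beta gamma : braid 3) :
  jones P (closure beta) = jones P (closure gamma) ->
  P (closure beta) = P (closure gamma).
Proof.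
wlog le_e : beta gamma / exponent beta <= exponent gamma.
  move=> H J; have [le|/ltW le] := lerP (exponent beta) (exponent gamma); first exact: H.
  exact/esym/H.
move=> J; have [c hc] := expandable_braid beta; have [c' hc'] := expandable_braid gamma.
have E := J; rewrite (jones_formula hP hc) (jones_formula hP hc') in E.
have {}E := same_jones_everywhere E.
have [m em] := zsign_eq (same_jones_parity hc hc' E).
have [n nm] : exists n : nat, m = n by exists (absz m); lia.
subst m; have [n0|n0] := posnP n.
  have ee : exponent beta = exponent gamma by rewrite em n0 !addr0.
  apply: (homflypt_determined hP hc hc' ee).
  have := E _ _ sqrt_t_neq0; rewrite /jones_expr -ee => /addrI.
  by apply: mulfI; rewrite expfz_neq0 ?sqrt_t_neq0.
rewrite em in E.
(* If [n = 1], both traces are those of the torus link of type [(2, e + 1)]. *)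
have [n1|[n2 e2]] := exponent_gap n0 E (burau_trace_bounded hc) (burau_trace_bounded hc').
  apply: (homflypt_same_pair hP n0 em _ _ J (homflypt_power_word P (exponent beta + 1))).
    by rewrite exponent_power_word addrK.
  by rewrite exponent_power_word em n1 -addrA.
(* If [n = 2], the exponent sums are [-2] and [2], as for these diagrams of the unknot. *)
apply: (@homflypt_same_pair P hP n beta gamma (braid_of [:: (letter1, false); (letter2, false)])
  (braid_of [:: (letter1, true); (letter2, true)])) => //.
- by rewrite e2 !braid_of_cons /= !exponentE.
- by rewrite em e2 n2 !braid_of_cons /= !exponentE.
- by rewrite !(closure_unknot12 (homflypt_invariant hP)).
Qed.
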